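(* Let $N\geq 1$, $0=x_0<x_1<\dots<x_{N+1}=1$, let $L:[0,1]\to\mathbb{R}$ be affine with $L_j:=L(x_j)$ and $L_0,L_{N+1}>0$. Let $\lambda=(\lambda_0,\dots,\lambda_{N+1})\in[0,+\infty)^{N+2}$ with $\lambda_0=\lambda_{N+1}=0$ and $p_j(\lambda)\geq 0$ for $1\le j\le N$, and let $\beta=(\beta_0,\dots,\beta_{N+1})\in\mathsf{Compa}(\lambda)$. Set, for $0\leq j\leq N+1$, $$\ell_j^+=L_j+\lambda_j+\beta_j,\qquad \ell_j^-=L_j+\lambda_j-\beta_j,\qquad w_j=\ell_j^++\ell_j^-=2\lambda_j+2L_j,$$ and let $V^\beta_j$ be the vertical segment $\{x_j\}\times[-\ell_j^-,\ell_j^+]$. Then, writing $u_j=u_0+x_j(u_{N+1}-u_0)$ for $u_0,u_{N+1}\in\mathbb{R}$ and $\complement A=\{1,\dots,N\}\setminus A$, $$\big\langle V^\beta_0,\dots,V^\beta_{N+1}\big\rangle=\int_{-L_0}^{L_0}\int_{-L_{N+1}}^{L_{N+1}}\ \sum_{A\subset\{1,\dots,N\}}\ \prod_{j\in A}\frac{\ell_j^+-u_j}{w_j}\prod_{j\in\complement A}\frac{\ell_j^-+u_j}{w_j}\ \big\langle \mathsf{Cb}[x_j,\ell_j^+-u_j]_{j\in A}\big\rangle\,\big\langle \mathsf{Cb}[x_j,\ell_j^-+u_j]_{j\in\complement A}\big\rangle\ \frac{du_{N+1}\,du_{0}}{w_0w_{N+1}},$$ where $u_0$ ranges over $[-L_0,L_0]$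 and $u_{N+1}$ over $[-L_{N+1},L_{N+1}]$.
   Context: A tuple of points of the plane is in convex position if the points are distinct and are exactly the vertices of a convex polygon (no point lies in the convex hull of the others); two distinct points are considered to be in convex position. For segments $S_0,\dots,S_{n-1}$ of the plane (possibly reduced to points), $\langle S_0,\dots,S_{n-1}\rangle$ denotes the probability that $(U_0,\dots,U_{n-1})$ is in convex position, where the $U_j$ are independent and $U_j$ is uniform on $S_j$ (deterministic if $S_j$ is a point). Write $\Delta y_j=y_j-y_{j-1}$. For $\lambda,\beta\in\mathbb{R}^{N+2}$ and $1\leq j\leq N$, set $$p_j(\lambda)=\frac{\Delta\lambda_j}{\Delta x_j}-\frac{\Delta\lambda_{j+1}}{\Delta x_{j+1}},\qquad q_j(\beta)=\frac{\Delta\beta_j}{\Delta x_j}-\frac{\Delta\beta_{j+1}}{\Delta x_{j+1}},$$ and $$\mathsf{Compa}(\lambda)=\{\beta\in\mathbb{R}^{N+2}:\ \beta_0=\beta_{N+1}=0,\ |\beta_j|\leq\lambda_j \text{ for all } j,\ |q_j(\beta)|\leq p_j(\lambda)\ \text{ for } 1\leq j\leq N\}.$$ Orthogonal comb: for $m\geq0$, $0<y_1<\dots<y_m<1$ and $h_1,\dots,h_m\geq0$, $\mathsf{Cb}[y_j,h_j]_{1\leq j\leq m}$ is the sequence of $m+2$ vertical segments $\{y_j\}\times[0,h_j]$, $0\leq j\leq m+1$, where $y_0=0,\ y_{m+1}=1,\ h_0=h_{m+1}=0$ (so the two extreme segments are the points $(0,0)$ and $(1,0)$). For a finite index set $A$,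 $\mathsf{Cb}[y_j,h_j]_{j\in A}$ denotes the comb built on the pairs $(y_j,h_j)$, $j\in A$, in increasing order of $j$, together with the two extreme points $(0,0)$, $(1,0)$; the value for $A=\varnothing$ is $\langle\mathsf{Cb}[\varnothing]\rangle=1$. *)

(* Defs.v *)
From HB Require Import structures.
From mathcomp Require Import all_boot all_order all_algebra.
From mathcomp Require Import all_classical all_reals all_analysis measurable_realfun.
Import Order.TTheory GRing.Theory Num.Theory.
Import numFieldNormedType.Exports.

Set Implicit Arguments.
Unset Strict Implicit.
Unset Printing Implicit Defensive.

Local Open Scope classical_set_scope.
Local Open Scope ring_scope.

Section convex_position.
Context {R : realType}.

(* R^o equips the plane with its vector space structure over R, which is what
   convex_set needs; R^o is convertible to R. *)
Definition convex_hull (A : set (R * R)) : set (R * R) :=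
  smallest (@convex_set R (R^o * R^o)%type) A.

Definition convex_position n (p : n.-tuple (R * R)) : Prop :=
  injective (tnth p) /\
  forall i, ~ convex_hull [set tnth p j | j in [set j | j != i]] (tnth p i).

End convex_position.

Section product_law.
Context {d} {T : measurableType d} {R : realType}.

Definition cons_pair n (z : T * n.-tuple T) : n.+1.-tuple T :=
  [tuple of z.1 :: z.2].

Lemma measurable_cons_pair n : measurable_fun [set: T * n.-tuple T] (@cons_pair n).
Proof. exact: measurable_cons. Qed.

HB.instance Definition _ n := @isMeasurableFun.Build _ _ _ _
  (@cons_pair n) (@measurable_cons_pair n).

(* Joint law of independent random variables U_0, ..., U_(n-1), U_j of law
   mu j: the only probability satisfying product_law_box below. *)
Fixpoint product_law n : ('I_n -> probability T R) -> probability (n.-tuple T) R :=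
  if n is m.+1 then fun mu =>
    distribution (mu ord0 \x product_law (fun i => mu (lift ord0 i)))%E
      (@cons_pair m)
  else fun=> dirac [tuple].

Lemma product_law_box n (mu : 'I_n -> probability T R) (B : 'I_n -> set T) :
  (forall i, measurable (B i)) ->
  product_law mu [set t | forall i, B i (tnth t i)] = (\prod_(i < n) mu i (B i))%E.
Proof.
elim: n mu B => [|n IH] mu B mB.
  rewrite big_ord0 /= diracE (_ : _ \in _ = true)//.
  by apply/mem_set => -[].
have mbox : measurable [set t : n.-tuple T | forall i, B (lift ord0 i) (tnth t i)].
  rewrite (_ : [set _ | _] = \bigcap_(i in [set: 'I_n])
      ((fun t : n.-tuple T => tnth t i) @^-1` B (lift ord0 i))); last first.
    by apply/seteqP; split => t /= Bt i; [move=> _|]; exact: Bt.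
  apply: fin_bigcap_measurable => // i _.
  by rewrite -[X in measurable X]setTI; exact: measurable_tnth.
rewrite big_ord_recl/= /distribution /pushforward /=.
rewrite (_ : _ @^-1` _ = B ord0 `*`
    [set t | forall i, B (lift ord0 i) (tnth t i)]); last first.
  apply/seteqP; split => [[x t]/= H|[x t]/= [H0 H] i].
    by split; [exact: (H ord0)|move=> i; have := H (lift ord0 i); rewrite tnthS].
  have [j ->|->] := unliftP ord0 i; last by rewrite tnth0.
  by rewrite tnthS.
rewrite product_measure1E//; congr (_ * _)%E; exact: IH.
Qed.

End product_law.

(* A segment is given by its two endpoints, which may coincide. *)
Definition segment (R : realType) : Type := ((R * R) * (R * R))%type.

Section segment.
Context {R : realType}.
Implicit Types S : segment R.

Definition segment_path S (t : measurableTypeR R) : R * R :=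
  ((1 - t) * S.1.1 + t * S.2.1, (1 - t) * S.1.2 + t * S.2.2).

Lemma measurable_segment_path S : measurable_fun [set: measurableTypeR R] (segment_path S).
Proof.
by apply: measurable_fun_pair; apply: measurable_funD;
  apply: measurable_funM => //; exact: measurable_funB.
Qed.

HB.instance Definition _ S := @isMeasurableFun.Build _ _ _ _
  (segment_path S) (@measurable_segment_path S).

(* The affine parametrization carries the uniform law on [0, 1] to the uniform
   law on the segment, and to the Dirac mass when the segment is a point. *)
Definition uniform_segment S : probability (R * R)%type R :=
  distribution (uniform_prob (@ltr01 R)) (segment_path S).

Definition convex_position_prob n (S : n.-tuple (segment R)) : R :=
  fine (product_law (fun j => uniform_segment (tnth S j))
    [set p | convex_position p]).

Definition vsegment (x a b : R) : segment R := ((x, a), (x, b)).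

Definition comb m (yh : m.-tuple (R * R)) : m.+2.-tuple (segment R) :=
  [tuple of vsegment 0 0 0 ::
    rcons [seq vsegment p.1 0 p.2 | p <- yh] (vsegment 1 0 0)].

End segment.

(* enum A lists the elements of A in increasing order. *)
Definition comb_on (R : realType) n (A : {set 'I_n}) (y h : 'I_n -> R) :
    #|A|.+2.-tuple (segment R) :=
  comb [tuple of [seq (y j, h j) | j <- enum_tuple A]].

Definition affine_on (R : realType) (D : set R) (L : R -> R) : Prop :=
  exists a b : R, forall t, D t -> L t = a * t + b.

Section comparison.
Context {R : realType} {N : nat}.
Implicit Types x y lam beta : 'I_N.+2 -> R.

(* Meant for 1 <= j <= N + 1. *)
Definition increment y (j : nat) : R := y (inord j) - y (inord j.-1).

(* p_j(lambda) = slope_drop x lambda j and q_j(beta) = slope_drop x beta j,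
   for 1 <= j <= N. *)
Definition slope_drop x y (j : nat) : R :=
  increment y j / increment x j - increment y j.+1 / increment x j.+1.

Definition Compa x lam : set ('I_N.+2 -> R) :=
  [set beta | [/\ beta ord0 = 0, beta ord_max = 0,
    forall j, `|beta j| <= lam j &
    forall j : nat, (1 <= j <= N)%N ->
      `|slope_drop x beta j| <= slope_drop x lam j]].

End comparison.

Definition inner_indices (N : nat) : {set 'I_N.+2} :=
  [set j : 'I_N.+2 | (1 <= j <= N)%N].

(* Main.v *)
(* Condition on the heights u_0 and u_(N+1) of the end points. The chord between
   them meets every segment, so each inner point lies above the chord with
   probability (l_j^+ - u_j) / w_j and is then uniform on the upper part of its
   segment, and similarly below: the law of the inner points is a mixture over
   the set A of the points above the chord. Points in convex position with the
   two end points on the chord decouple: the whole family is in convex position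
   iff the upper and the lower families, each completed by the end points, are.
   These two families are independent, and a shear, followed by a reflection for
   the lower one, turns each into an orthogonal comb.
   Measurability of convex position comes from a criterion by polynomial
   inequalities: the origin is outside the hull of finitely many vectors iff one
   of them is an extreme ray, all others being within a half-turn from it. *)
Require Import Defs.
From HB Require Import structures.
From mathcomp Require Import all_boot all_order all_algebra.
From mathcomp Require Import all_classical all_reals all_analysis measurable_realfun.
From mathcomp Require Import ring lra.
Import Order.TTheory GRing.Theory Num.Theory.
Import numFieldNormedType.Exports.

Set Implicit Arguments.
Unset Strict Implicit.
Unset Printing Implicit Defensive.

Local Open Scope classical_set_scope.
Local Open Scope ring_scope.

(** * Convex hulls and the chord *)

Section hull.
Context {R : realType}.
Implicit Types (A B C S U : set (R * R)) (p q z : R * R).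

Definition mix (t : R) p q : R * R :=
  (t * p.1 + (1 - t) * q.1, t * p.2 + (1 - t) * q.2).

(** Convexity in coordinates with a plain real weight, so that arithmetic tactics apply;
    [convex_set2P] ties it to the convexity used by [convex_hull]. *)
Definition convex2 C := forall p q t, 0 <= t <= 1 -> C p -> C q -> C (mix t p q).

Lemma convex_set2P C : @convex_set R (R^o * R^o)%type C <-> convex2 C.
Proof.
split=> cC.
  move=> p q t t01 /mem_set Cp /mem_set Cq.
  have := cC p q (Itv01 (proj1 (andP t01)) (proj2 (andP t01))) Cp Cq.
  by move/set_mem.
move=> p q t /set_mem Cp /set_mem Cq; apply/mem_set.
by apply: (cC p q t%:num) => //; apply/andP; split; [exact: ge0|exact: le1].
Qed.

Lemma sub_convex_hull A : A `<=` convex_hull A.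
Proof. exact: sub_gen_smallest. Qed.

Lemma convex_hull_sub A C : convex2 C -> A `<=` C -> convex_hull A `<=` C.
Proof. by move=> /convex_set2P cC AC; exact: smallest_sub. Qed.

Lemma convex2_hull A : convex2 (convex_hull A).
Proof.
move=> p q t t01 Ap Aq C [cC AC].
by apply: (proj1 (convex_set2P C)) => //; [exact: Ap|exact: Aq].
Qed.

Lemma convex_hullS A B : A `<=` B -> convex_hull A `<=` convex_hull B.
Proof.
move=> AB; apply: convex_hull_sub; first exact: convex2_hull.
exact: subset_trans (@sub_convex_hull B).
Qed.

Lemma convex_hull_image (phi : R * R -> R * R) A z :
  (forall t p q, phi (mix t p q) = mix t (phi p) (phi q)) ->
  convex_hull A z -> convex_hull (phi @` A) (phi z).
Proof.
move=> phiM; apply: (@convex_hull_sub A (phi @^-1` (convex_hull (phi @` A)))).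
  by move=> p q t t01 Ap Aq; rewrite /preimage/= phiM; exact: convex2_hull.
by move=> p Ap; apply: sub_convex_hull; exists p.
Qed.

(** Points of [S] on or below the axis bring nothing new above it: a segment going down from the
    hull of [U] leaves the upper half-plane through the chord from (0, 0) to (1, 0), which already
    lies in that hull. *)
Lemma upper_notin_convex_hull S U z :
  (forall s, S s -> 0 <= s.1 <= 1) ->
  (forall s, S s -> 0 < s.2 -> U s) ->
  U (0, 0) -> U (1, 0) -> 0 <= z.1 <= 1 -> 0 <= z.2 ->
  ~ convex_hull U z -> ~ convex_hull S z.
Proof.
move=> S01 SU U0 U1 z01 z2 nUz Sz.
have UK p : 0 <= p.1 <= 1 -> p.2 = 0 -> convex_hull U p.
  move=> p01 p2; rewrite (_ : p = mix (1 - p.1) (0, 0) (1, 0)); last first.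
    by rewrite /mix/= !mulr0 addr0 add0r mulr1 subKr -p2; case: p {p01 p2}.
  by apply: convex2_hull; [lra|exact: sub_convex_hull..].
(* A convex set that traps the hull of [S]: below the axis only the abscissa is controlled, so that
   crossings of the axis fall on the chord. *)
pose C p := 0 <= p.1 <= 1 /\ (0 < p.2 -> convex_hull U p).
have CM p q t : 0 <= t <= 1 -> C p -> C q -> q.2 <= 0 -> C (mix t p q).
  move=> t01 [p01 Up] [q01 Uq] q2; split => /=; first by nra.
  move=> m0; have p2 : 0 < p.2 by nra.
  have d0 : 0 < p.2 - q.2 by lra.
  (* [e] is the point where the segment from [p] to [q] crosses the axis; a mixture above the axis
     lies between [p] and [e]. *)
  pose e := mix (- q.2 / (p.2 - q.2)) p q.
  have h0 : 0 <= - q.2 / (p.2 - q.2) <= 1.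
    by rewrite divr_ge0 ?oppr_ge0 ?(ltW d0)//= ler_pdivrMr//; lra.
  have e2 : e.2 = 0 by rewrite /e/=; field; rewrite gt_eqF.
  have e1 : 0 <= e.1 <= 1.
    by rewrite /e/=; move: h0; set r := _ / _ => h0; nra.
  rewrite (_ : mix t p q = mix ((t * p.2 + (1 - t) * q.2) / p.2) p e).
    apply: convex2_hull; [|exact: Up|exact: UK].
    by rewrite divr_ge0 ?(ltW m0) ?(ltW p2)//= ler_pdivrMr//; nra.
  by rewrite /e /mix/=; congr (_, _); field; rewrite !gt_eqF.
have cC : convex2 C.
  move=> p q t t01 Cp Cq.
  have [q2|q2] := leP q.2 0; first exact: CM.
  have [p2|p2] := leP p.2 0.
    rewrite (_ : mix t p q = mix (1 - t) q p); last first.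
      by rewrite /mix; congr (_, _); ring.
    by apply: CM => //; lra.
  case: Cp Cq => p01 Up [q01 Uq].
  split=> [/=|_]; first by nra.
  by apply: convex2_hull => //; [exact: Up|exact: Uq].
have [_ Cz] : C z.
  apply: (convex_hull_sub cC _ Sz) => s Ss; split; first exact: S01.
  by move=> s2; apply: sub_convex_hull; exact: SU.
(* [C] says nothing of the hull at height 0, but there [z] is on the chord. *)
move: z2; rewrite le_eqVlt => /predU1P[/esym z2|/Cz//].
by apply: nUz; exact: UK.
Qed.

End hull.

Section convex_position.
Context {R : realType}.

Lemma convex_position_sub m n (f : 'I_m -> 'I_n) (p : n.-tuple (R * R))
    (q : m.-tuple (R * R)) : injective f ->
  (forall i, tnth q i = tnth p (f i)) -> convex_position p -> convex_position q.
Proof.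
move=> fI qp [pI pN]; split=> [i j|i qi].
  by rewrite !qp => /pI /fI.
apply: (pN (f i)); rewrite -qp; apply: convex_hullS qi => _ [j ij <-].
by exists (f j); [rewrite /= (inj_eq fI)|rewrite qp].
Qed.

(** An affine map carries coincidences and hull memberships forward, so convex position pulls back.
    For an invertible map, this is applied to the map and to its inverse. *)
Lemma convex_position_affine n (phi : R * R -> R * R) (p q : n.-tuple (R * R)) :
  (forall t a b, phi (mix t a b) = mix t (phi a) (phi b)) ->
  (forall i, tnth q i = phi (tnth p i)) -> convex_position q -> convex_position p.
Proof.
move=> phiM qp [qI qN]; split=> [i j pij|i pi].
  by apply: qI; rewrite !qp pij.
apply: (qN i); rewrite qp.
have := convex_hull_image phiM pi; apply: convex_hullS => _ [_ [j ij <-] <-].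
by exists j.
Qed.

Let flip (z : R * R) : R * R := (z.1, - z.2).

Let flipM t a b : flip (mix t a b) = mix t (flip a) (flip b).
Proof. by rewrite /flip /mix/=; congr (_, _); ring. Qed.

Let flipK z : flip (flip z) = z.
Proof. by case: z => a b; rewrite /flip/= opprK. Qed.

(** Mirror image of [upper_notin_convex_hull] under [flip]. *)
Lemma lower_notin_convex_hull (S U : set (R * R)) z :
  (forall s, S s -> 0 <= s.1 <= 1) ->
  (forall s, S s -> s.2 < 0 -> U s) ->
  U (0, 0) -> U (1, 0) -> 0 <= z.1 <= 1 -> z.2 <= 0 ->
  ~ convex_hull U z -> ~ convex_hull S z.
Proof.
move=> S01 SU U0 U1 z01 z2 nUz Sz.
have := convex_hull_image flipM Sz.
apply: (@upper_notin_convex_hull _ _ (flip @` U)).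
- by move=> _ [s Ss <-]; exact: (S01 _ Ss).
- move=> _ [s Ss <-] /=; rewrite oppr_gt0 => s2; exists s => //; exact: SU.
- by exists (0, 0) => //; rewrite /flip/= oppr0.
- by exists (1, 0) => //; rewrite /flip/= oppr0.
- by [].
- by rewrite /= oppr_ge0.
- move=> h; apply: nUz; have := convex_hull_image flipM h; rewrite flipK.
  by apply: convex_hullS => _ [_ [s Us <-] <-]; rewrite flipK.
Qed.

(* A vertex on one side of the chord that lies in the hull of all other points
   already lies in the hull of the other points on its side. *)
Lemma convex_position_chord n k l (p : n.-tuple (R * R)) (a b : 'I_n)
    (f : 'I_k -> 'I_n) (g : 'I_l -> 'I_n)
    (pf : k.-tuple (R * R)) (pg : l.-tuple (R * R)) :
  injective f -> injective g ->
  (forall i, tnth pf i = tnth p (f i)) -> (forall i, tnth pg i = tnth p (g i)) ->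
  tnth p a = (0, 0) -> tnth p b = (1, 0) ->
  (forall j, j != a -> j != b -> 0 < (tnth p j).1 < 1) ->
  injective (fun j => (tnth p j).1) ->
  range f a -> range f b -> range g a -> range g b ->
  (forall j, range f j -> 0 <= (tnth p j).2) ->
  (forall j, range g j -> (tnth p j).2 <= 0) ->
  (forall j, range f j \/ range g j) ->
  convex_position p <-> convex_position pf /\ convex_position pg.
Proof.
move=> fI gI pfE pgE pa pb p01 pI fa fb ga gb fge gle fg.
split=> [pC|[[_ pfN] [_ pgN]]].
  by split; [exact: (convex_position_sub fI pfE)|exact: (convex_position_sub gI pgE)].
split=> [i j pij|i]; first by apply: pI; congr (_.1).
have p01' j : 0 <= (tnth p j).1 <= 1.
  have [->|ja] := eqVneq j a; first by rewrite pa/= lexx ler01.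
  have [->|jb] := eqVneq j b; first by rewrite pb/= lexx ler01.
  by have := p01 _ ja jb; lra.
(* The end points are handled apart: all other points lie in the open half-plane [0 < z.1] for [a],
   and in [z.1 < 1] for [b]. *)
have [->|ia] := eqVneq i a.
  suff : convex_hull [set tnth p j | j in [set j | j != a]] `<=` [set z | 0 < z.1].
    by move=> /[apply]; rewrite pa /= ltxx.
  apply: convex_hull_sub => [y z t t01 /= y1 z1|_ [j /= ja <-]].
    by have [->|] := eqVneq t 0; nra.
  have [->|jb] := eqVneq j b; first by rewrite pb.
  by have := p01 _ ja jb; lra.
have [->|ib] := eqVneq i b.
  suff : convex_hull [set tnth p j | j in [set j | j != b]] `<=` [set z | z.1 < 1].
    by move=> /[apply]; rewrite pb /= ltxx.
  apply: convex_hull_sub => [y z t t01 /= y1 z1|_ [j /= jb <-]].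
    by have [->|] := eqVneq t 0; nra.
  have [->|ja] := eqVneq j a; first by rewrite pa.
  by have := p01 _ ja jb; lra.
(* Since [i] is neither end, both ends of the chord remain available among the other points of its
   side. *)
have side (h : 'I_n -> Prop) : h a -> h b ->
    [set tnth p j | j in [set j | h j /\ j != i]] (0, 0) /\
    [set tnth p j | j in [set j | h j /\ j != i]] (1, 0).
  by split; [exists a|exists b] => //; split => //; rewrite eq_sym.
case: (fg i) => [ri|ri].
- have [U0 U1] := side _ fa fb.
  apply: (upper_notin_convex_hull _ _ U0 U1 (p01' i) (fge _ ri)).
  + by move=> _ [j _ <-]; exact: p01'.
  + move=> _ [j ji <-] j0; exists j => //; split=> //.
    by case: (fg j) => // /gle; rewrite leNgt j0.
  + case: ri => i' _ fi'; rewrite -fi' -pfE; apply: contra_not (pfN i').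
    apply: convex_hullS => _ [j [[j' _ <-] ji] <-].
    by exists j'; [rewrite /= -(inj_eq fI)|rewrite pfE].
- have [U0 U1] := side _ ga gb.
  apply: (lower_notin_convex_hull _ _ U0 U1 (p01' i) (gle _ ri)).
  + by move=> _ [j _ <-]; exact: p01'.
  + move=> _ [j ji <-] j0; exists j => //; split=> //.
    by case: (fg j) => // /fge; rewrite leNgt j0.
  + case: ri => i' _ gi'; rewrite -gi' -pgE; apply: contra_not (pgN i').
    apply: convex_hullS => _ [j [[j' _ <-] ji] <-].
    by exists j'; [rewrite /= -(inj_eq gI)|rewrite pgE].
Qed.

End convex_position.

(** * Measurability of convex position *)

Section measurable_convex_position.
Context {R : realType}.
Implicit Types (v w z : R * R).

Definition crossp v w := v.1 * w.2 - v.2 * w.1.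
Definition dotp v w := v.1 * w.1 + v.2 * w.2.

(* w lies within a half-turn counterclockwise from the ray of v, the ray itself
   included and the opposite one excluded. *)
Definition ahead v w := (0 < crossp v w) || ((crossp v w == 0) && (0 < dotp v w)).

(** Both [crossp v] and [dotp v] are linear. The weights 0 and 1 are split off because strict
    inequalities survive only under positive weights. *)
Lemma convex_ahead v : convex2 [set w | ahead v w].
Proof.
move=> p q t t01 /= Hp Hq.
have [->|t0] := eqVneq t 0.
  by rewrite /mix !mul0r !add0r subr0 !mul1r -surjective_pairing.
have [->|t1] := eqVneq t 1.
  by rewrite /mix subrr !mul0r !addr0 !mul1r -surjective_pairing.
have {t0}t0 : 0 < t by rewrite lt0r t0; case/andP: t01.
have {t1}t1 : 0 < 1 - t by rewrite subr_gt0 lt_neqAle t1; case/andP: t01.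
have cE : crossp v (mix t p q) = t * crossp v p + (1 - t) * crossp v q.
  by rewrite /crossp /mix/=; ring.
have dE : dotp v (mix t p q) = t * dotp v p + (1 - t) * dotp v q.
  by rewrite /dotp /mix/=; ring.
rewrite /ahead cE dE.
case/orP: Hp => [p0|/andP[/eqP-> p0]]; case/orP: Hq => [q0|/andP[/eqP-> q0]].
- by rewrite addr_gt0 ?mulr_gt0.
- by rewrite mulr0 addr0 mulr_gt0.
- by rewrite mulr0 add0r mulr_gt0.
- by rewrite !mulr0 addr0 eqxx ltxx/= addr_gt0 ?mulr_gt0.
Qed.

(** The normalisation of the weights is done here once, so that cross and dot products can serve
    directly as coefficients. *)
Lemma convex_hull3 (A : set (R * R)) p q r (a b c : R) :
  0 <= a -> 0 <= b -> 0 <= c -> 0 < a + b + c -> A p -> A q -> A r ->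
  a * p.1 + b * q.1 + c * r.1 = 0 -> a * p.2 + b * q.2 + c * r.2 = 0 ->
  convex_hull A (0, 0).
Proof.
move=> a0 b0 c0 s0 /sub_convex_hull Ap /sub_convex_hull Aq /sub_convex_hull Ar e1 e2.
(* The nested mixture divides by [b + c]; when this vanishes, [p] itself is the origin. *)
have [bc|bc] := eqVneq (b + c) 0.
  have b00 : b = 0 by lra.
  have c00 : c = 0 by lra.
  move: e1 e2 s0; rewrite b00 c00 !mul0r !addr0 => e1 e2 s0.
  have p1 : p.1 = 0 by apply: (mulfI (lt0r_neq0 s0)); rewrite e1 mulr0.
  have p2 : p.2 = 0 by apply: (mulfI (lt0r_neq0 s0)); rewrite e2 mulr0.
  by rewrite -[X in (X, _)]p1 -[X in (_, X)]p2 -surjective_pairing.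
have bc0 : 0 < b + c by rewrite lt0r bc addr_ge0.
rewrite (_ : (0, 0) = mix (a / (a + b + c)) p (mix (b / (b + c)) q r)).
  apply: convex2_hull => //; last apply: convex2_hull => //.
    by rewrite divr_ge0 ?(ltW s0)//= ler_pdivrMr//; lra.
  by rewrite divr_ge0 ?(ltW bc0)//= ler_pdivrMr//; lra.
rewrite /mix/=; congr (_, _).
  transitivity ((a * p.1 + b * q.1 + c * r.1) / (a + b + c)).
    by rewrite e1 mul0r.
  by field; rewrite !gt_eqF.
transitivity ((a * p.2 + b * q.2 + c * r.2) / (a + b + c)).
  by rewrite e2 mul0r.
by field; rewrite !gt_eqF.
Qed.

(* If v turns clockwise from the extreme ray k of s, then v is the new extreme
   ray: otherwise v, k and some w in s positively span the plane. *)
Lemma ahead_extreme (s : seq (R * R)) : ~ convex_hull [set` s] (0, 0) ->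
  s = [::] \/ exists2 v, v \in s & forall w, w \in s -> ahead v w.
Proof.
elim: s => [|v s IH] nv; [by left|right].
(* A vector of [s] collinear with [v] points the same way; otherwise the relation
   [dotp v v * w = dotp v w * v] puts the origin in the hull. *)
have h2 w : w \in s -> crossp v w = 0 -> 0 < dotp v w.
  move=> ws vw; rewrite ltNge; apply/negP => d0; apply: nv.
  have mw : [set` v :: s] w by rewrite /= inE ws orbT.
  have mv : [set` v :: s] v by rewrite /= mem_head.
  have [v0|v0] := eqVneq (dotp v v) 0.
    have v1 : v.1 = 0 by move: v0; rewrite /dotp; nra.
    have v2 : v.2 = 0 by move: v0; rewrite /dotp; nra.
    by apply: (@convex_hull3 _ v v v 1 0 0) => //; rewrite ?v1 ?v2; lra.
  have vv0 : 0 < dotp v v by rewrite lt0r v0 /dotp; nra.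
  apply: (@convex_hull3 _ v v w (- dotp v w) 0 (dotp v v)) => //;
    rewrite ?oppr_ge0 ?(ltW vv0)//; first by lra.
    transitivity (- v.2 * crossp v w); first by rewrite /crossp /dotp; ring.
    by rewrite vw mulr0.
  transitivity (v.1 * crossp v w); first by rewrite /crossp /dotp; ring.
  by rewrite vw mulr0.
have vv : ahead v v.
  rewrite /ahead /crossp mulrC subrr eqxx ltxx/= lt0r; apply/andP; split; last first.
    by rewrite /dotp; nra.
  apply/eqP => v0; apply: nv.
  have mv : [set` v :: s] v by rewrite /= mem_head.
  have v1 : v.1 = 0 by move: v0; rewrite /dotp; nra.
  have v2 : v.2 = 0 by move: v0; rewrite /dotp; nra.
  by apply: (@convex_hull3 _ v v v 1 0 0) => //; rewrite ?v1 ?v2; lra.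
case: IH => [h|->|[k ks kA]].
- by apply: nv; apply: convex_hullS h => w /= ws; rewrite inE ws orbT.
- by exists v => [|w]; rewrite inE//= => /eqP->.
have [kv|kv] := leP 0 (crossp k v).
  exists k => [|w]; first by rewrite inE ks orbT.
  rewrite inE => /predU1P[->|/kA//].
  rewrite /ahead; have [//|k0] := ltP 0 (crossp k v).
  have {}k0 : crossp k v = 0 by lra.
  rewrite k0 eqxx/=; rewrite (_ : dotp k v = dotp v k); last by rewrite /dotp; ring.
  by apply: h2 => //; move: k0; rewrite /crossp; lra.
exists v => [|w]; first exact: mem_head.
rewrite inE => /predU1P[->//|ws].
rewrite /ahead; have [//|w0] := ltP 0 (crossp v w).
have [w1|w1] := eqVneq (crossp v w) 0; first by rewrite /= h2.
have {w1}w0 : crossp v w < 0 by rewrite lt_neqAle w1.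
exfalso; apply: nv.
have kw : 0 <= crossp k w.
  by case/orP: (kA _ ws) => [/ltW//|/andP[/eqP->]].
(* Coefficients of the planar identity [crossp k w * v + crossp w v * k + crossp v k * w = 0], all
   nonnegative here. *)
apply: (@convex_hull3 _ v k w (crossp k w) (- crossp v w) (- crossp k v)) => //.
- by lra.
- by lra.
- by lra.
- exact: mem_head.
- by rewrite /= inE ks orbT.
- by rewrite /= inE ws orbT.
- by rewrite /crossp; ring.
- by rewrite /crossp; ring.
Qed.

Definition vec z w : R * R := (w.1 - z.1, w.2 - z.2).

(** After translating the point [i] to the origin, this is [ahead_extreme]; conversely the set of
    vectors ahead of a given one is convex and misses the origin. Only finite quantifiers and
    polynomial inequalities remain. *)
Lemma notin_convex_hullP n (p : n.-tuple (R * R)) i :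
  ~ convex_hull [set tnth p j | j in [set j | j != i]] (tnth p i) <->
  exists k, forall j, j != i -> ahead (vec (tnth p i) (tnth p k)) (vec (tnth p i) (tnth p j)).
Proof.
set z := tnth p i.
have vecM t a b : vec z (mix t a b) = mix t (vec z a) (vec z b).
  by rewrite /vec /mix/=; congr (_, _); ring.
have z0 : vec z z = (0, 0) by rewrite /vec !subrr.
split=> [nz|[k kA] hz].
  pose s := [seq vec z (tnth p j) | j <- enum 'I_n & j != i].
  have ms j : j != i -> vec z (tnth p j) \in s.
    by move=> ji; apply/mapP; exists j => //; rewrite mem_filter ji mem_enum.
  have [h|s0|[v vs vA]] := @ahead_extreme s.
  - apply: nz.
    pose back (w : R * R) : R * R := (w.1 + z.1, w.2 + z.2).
    have backM t a b : back (mix t a b) = mix t (back a) (back b).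
      by rewrite /back /mix/=; congr (_, _); ring.
    have := convex_hull_image backM h; rewrite /back/= !add0r -surjective_pairing.
    apply: convex_hullS => _ [w + <-] => /mapP[j]; rewrite mem_filter => /andP[ji _] ->.
    by exists j => //; rewrite /back/= !subrK -surjective_pairing.
  (* There is no other point, so the condition on [k] is vacuous and [i] is an arbitrary choice. *)
  - exists i => j /ms; by rewrite s0.
  - case/mapP: vs => k _ vE; exists k => j ji; rewrite -vE; apply: vA; exact: ms.
have := convex_hull_image vecM hz; rewrite z0.
suff : convex_hull (vec z @` [set tnth p j | j in [set j | j != i]]) `<=`
    [set w | ahead (vec z (tnth p k)) w].
  move=> /[apply]; by rewrite /= /ahead /crossp /dotp/= !mulr0 subrr addr0 ltxx andbF.
apply: convex_hull_sub; first exact: convex_ahead.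
by move=> _ [_ [j ji <-] <-]; exact: kA.
Qed.

End measurable_convex_position.

Section measurable_quantifiers.
Context {d} {T : measurableType d} (I : finType).

Lemma measurable_forall (P : I -> set T) : (forall i, measurable (P i)) ->
  measurable [set x | forall i, P i x].
Proof.
move=> mP; rewrite (_ : [set _ | _] = \bigcap_(i in [set: I]) P i).
  by apply: fin_bigcap_measurable.
by apply/seteqP; split=> x /= Px i; [move=> _|]; exact: Px.
Qed.

Lemma measurable_exists (P : I -> set T) : (forall i, measurable (P i)) ->
  measurable [set x | exists i, P i x].
Proof.
move=> mP; rewrite (_ : [set _ | _] = \bigcup_(i in [set: I]) P i).
  by apply: fin_bigcup_measurable.
by apply/seteqP; split=> x /= [i]; [exists i|exists i].
Qed.

Lemma measurable_bool (f : T -> bool) : measurable_fun [set: T] f ->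
  measurable [set x | f x].
Proof. by move=> mf; rewrite -[X in measurable X]setTI; exact: (mf measurableT [set true]). Qed.

End measurable_quantifiers.

Lemma measurable_convex_position (R : realType) n :
  measurable [set p : n.-tuple (R * R) | convex_position p].
Proof.
have mx i : measurable_fun [set: n.-tuple (R * R)] (fun p => (tnth p i).1).
  by apply: (measurableT_comp measurable_fst); exact: measurable_tnth.
have my i : measurable_fun [set: n.-tuple (R * R)] (fun p => (tnth p i).2).
  by apply: (measurableT_comp measurable_snd); exact: measurable_tnth.
(* Injectivity and the hull condition become finite Boolean combinations of polynomial conditions in
   the coordinates. *)
rewrite (_ : [set _ | _] =
    [set p | forall i j : 'I_n, (i == j) || ~~ (((tnth p i).1 == (tnth p j).1) &&
                                 ((tnth p i).2 == (tnth p j).2))] `&`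
    [set p | forall i, exists k, forall j, (j == i) ||
      ahead (vec (tnth p i) (tnth p k)) (vec (tnth p i) (tnth p j))]); last first.
  apply/seteqP; split=> p /= [pI pN]; split.
  - move=> i j; have [//|ij] := eqVneq i j; apply: contra_neqN ij.
    move=> /andP[/eqP e1 /eqP e2]; apply: pI.
    by rewrite [LHS]surjective_pairing e1 e2 -surjective_pairing.
  - move=> i; have /notin_convex_hullP[k kA] := pN i.
    by exists k => j; have [//|ji] := eqVneq j i; exact: kA.
  - move=> i j pij; apply/eqP; move: (pI i j); by rewrite pij !eqxx orbF.
  - move=> i; apply/notin_convex_hullP; have [k kA] := pN i; exists k => j.
    by move=> /negbTE ji; have := kA j; rewrite ji.
apply: measurableI.
  do 2 apply: measurable_forall => ?.
  apply: measurable_bool; apply: measurable_or => //.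
  by apply: measurable_neg; apply: measurable_and; exact: measurable_fun_eqr.
apply: measurable_forall => i; apply: measurable_exists => k.
apply: measurable_forall => j; apply: measurable_bool; apply: measurable_or => //.
rewrite /ahead /crossp /dotp /=.
apply: measurable_or; last apply: measurable_and.
- apply: measurable_fun_ltr => //.
  by apply: measurable_funB; apply: measurable_funM; apply: measurable_funB.
- apply: measurable_fun_eqr => //.
  by apply: measurable_funB; apply: measurable_funM; apply: measurable_funB.
- apply: measurable_fun_ltr => //.
  by apply: measurable_funD; apply: measurable_funM; apply: measurable_funB.
Qed.

(** * Product laws *)

Definition box T n (B : 'I_n -> set T) : set (n.-tuple T) :=
  [set t | forall i, B i (tnth t i)].

Section tuple_measure.
Context {d} {T : measurableType d} {R : realType}.

Lemma measurable_box n (B : 'I_n -> set T) :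
  (forall i, measurable (B i)) -> measurable (box B).
Proof.
move=> mB; apply: measurable_forall => i.
by rewrite -[X in measurable X]setTI; exact: measurable_tnth.
Qed.

(** Boxes are stable under intersection and generate the product sigma-algebra. *)
Lemma tuple_measure_unique n (m1 m2 : {measure set (n.-tuple T) -> \bar R}) :
  (m1 setT < +oo)%E ->
  (forall B : 'I_n -> set T, (forall i, measurable (B i)) -> m1 (box B) = m2 (box B)) ->
  forall E, measurable E -> m1 E = m2 E.
Proof.
move=> m1oo m12.
pose G : set (set (n.-tuple T)) := [set box B | B in [set B | forall i, measurable (B i)]].
apply: (measure_unique G (fun=> setT)).
- apply/seteqP; split.
    apply: smallest_sub; first exact: smallest_sigma_algebra.
    case: n @G {m1 m2 m1oo m12} => [|n] G; first by rewrite big_ord0.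
    rewrite -bigcup_mkord_ord; apply: bigcup_sub => i _ _ [A mA <-].
    (* A generator constrains a single coordinate: it is the box whose other sides are full. *)
    apply: sub_sigma_algebra; exists (fun j => if j == inord i then A else setT) => /=.
      by move=> j; case: ifP.
    rewrite setTI; apply/seteqP; split=> t /=; first by move=> /(_ (inord i)); rewrite eqxx.
    by move=> tA j; case: eqP => // ->.
  apply: smallest_sub; first exact: sigma_algebra_measurable.
  by move=> _ [B mB <-]; exact: measurable_box.
- move=> _ _ [B mB <-] [C mC <-]; exists (fun i => B i `&` C i) => /=.
    by move=> i; exact: measurableI.
  by apply/seteqP; split=> t /= => [BC|[tB tC] i]; [split=> i; have [] := BC i|split].
- move=> _; exists (fun=> setT) => //=.
  by apply/seteqP.
- by rewrite bigcup_const//; exists 0%N.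
- by move=> _ [B mB <-]; exact: m12.
- by [].
Qed.

(** The tool behind the identities between product laws below: write the other side as a measure and
    compare on boxes. *)
Lemma product_law_unique n (mu : 'I_n -> probability T R)
    (m : {measure set (n.-tuple T) -> \bar R}) :
  (forall B : 'I_n -> set T, (forall i, measurable (B i)) ->
    m (box B) = (\prod_(i < n) mu i (B i))%E) ->
  forall E, measurable E -> product_law mu E = m E.
Proof.
move=> mE; apply: tuple_measure_unique => [|B mB].
  by rewrite -ge0_fin_numE// fin_num_measure.
by rewrite mE//; exact: product_law_box.
Qed.

Lemma eq_product_law n (mu nu : 'I_n -> probability T R) :
  (forall i A, measurable A -> mu i A = nu i A) ->
  forall E, measurable E -> product_law mu E = product_law nu E.
Proof.
move=> mn; apply: product_law_unique => B mB.
rewrite [LHS]product_law_box//.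
by apply: eq_bigr => i _; rewrite mn.
Qed.

Lemma measurable_map_tuple d' (T' : measurableType d') n (phi : T -> T') :
  measurable_fun setT phi ->
  measurable_fun [set: n.-tuple T] (fun t => [tuple phi (tnth t i) | i < n]).
Proof.
move=> mphi; apply/measurable_fun_tnthP => i.
rewrite (_ : _ \o _ = phi \o (fun t => tnth t i)).
  by apply: measurableT_comp => //; exact: measurable_tnth.
by apply/funext => t /=; rewrite tnth_mktuple.
Qed.

Lemma measurable_merge k l n (s : 'I_n -> 'I_k + 'I_l) :
  measurable_fun [set: k.-tuple T * l.-tuple T]
    (fun z => [tuple match s j with inl i => tnth z.1 i | inr i => tnth z.2 i end | j < n]).
Proof.
apply/measurable_fun_tnthP => j.
case sj : (s j) => [i|i].
  rewrite (_ : _ \o _ = (fun t => tnth t i) \o fst).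
    by apply: measurableT_comp => //; exact: measurable_tnth.
  by apply/funext => t /=; rewrite tnth_mktuple sj.
rewrite (_ : _ \o _ = (fun t => tnth t i) \o snd).
  by apply: measurableT_comp => //; exact: measurable_tnth.
by apply/funext => t /=; rewrite tnth_mktuple sj.
Qed.

End tuple_measure.

Section product_law_theory.
Context {d} {T : measurableType d} {R : realType}.

Lemma product_law_map d' (T' : measurableType d') n (mu : 'I_n -> probability T R)
    (nu : 'I_n -> probability T' R) (phi : T -> T') : measurable_fun setT phi ->
  (forall i A, measurable A -> nu i A = mu i (phi @^-1` A)) ->
  forall E, measurable E -> product_law nu E =
    product_law mu [set t | E [tuple phi (tnth t i) | i < n]].
Proof.
move=> mphi numu.
pose mf := isMeasurableFun.Build _ _ _ _ _ (@measurable_map_tuple _ T _ T' n _ mphi).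
pose f : {mfun n.-tuple T >-> n.-tuple T'} := HB.pack
  (fun t : n.-tuple T => [tuple phi (tnth t i) | i < n]) mf.
apply: (product_law_unique (m := distribution (product_law mu) f)) => B mB.
under eq_bigr do rewrite numu//.
rewrite -product_law_box; last by move=> i; rewrite -[X in measurable X]setTI; exact: (mphi).
rewrite /distribution /pushforward; congr (product_law mu _).
by apply/seteqP; split=> t /= tB i; have := tB i; rewrite tnth_mktuple.
Qed.

(* As s may miss some coordinates, which are then integrated out, the end points
   can belong to both families. *)
Lemma product_law_merge k l n (s : 'I_n -> 'I_k + 'I_l)
    (nu : 'I_k -> probability T R) (xi : 'I_l -> probability T R)
    (mu : 'I_n -> probability T R) : injective s ->
  (forall j A, measurable A ->
     mu j A = match s j with inl i => nu i A | inr i => xi i A end) ->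
  forall E, measurable E -> product_law mu E =
    (product_law nu \x product_law xi)%E [set z | E
      [tuple match s j with inl i => tnth z.1 i | inr i => tnth z.2 i end | j < n]].
Proof.
move=> sI mus.
pose mf := isMeasurableFun.Build _ _ _ _ _ (@measurable_merge _ T k l n s).
pose f : {mfun (k.-tuple T * l.-tuple T)%type >-> n.-tuple T} := HB.pack
  (fun z : k.-tuple T * l.-tuple T =>
  [tuple match s j with inl i => tnth z.1 i | inr i => tnth z.2 i end | j < n]) mf.
apply: (product_law_unique (m := distribution (product_law nu \x product_law xi)%E f)) => B mB.
transitivity ((product_law nu \x product_law xi)%E (f @^-1` box B)); first by [].
(* Side of the preimage box at the source coordinate [c]: that of the unique [j] reading [c], or the
   whole space if [c] is never read. *)
pose C (c : 'I_k + 'I_l) := if [pick j | s j == c] is Some j then B j else setT.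
have Cs j : C (s j) = B j.
  rewrite /C; case: pickP => [j' /eqP/sI->//|/(_ j)]; by rewrite eqxx.
have mC c : measurable (C c) by rewrite /C; case: pickP.
rewrite (_ : _ @^-1` _ = box (C \o inl) `*` box (C \o inr)); last first.
  apply/seteqP; split=> -[p q] /=.
    move=> pqB; split=> i /=; rewrite /C; case: pickP => // j /eqP sj.
      by have := pqB j; rewrite tnth_mktuple sj.
    by have := pqB j; rewrite tnth_mktuple sj.
  move=> [pC qC] j; rewrite tnth_mktuple -Cs.
  by case: (s j) => i; [exact: pC|exact: qC].
rewrite product_measure1E; [|by apply: measurable_box => i; exact: mC..].
transitivity ((\prod_i nu i (C (inl i))) * (\prod_i xi i (C (inr i))))%E.
  by congr (_ * _)%E; apply: product_law_box => i; exact: mC.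
transitivity (\prod_c match c with inl i => nu i (C c) | inr i => xi i (C c) end)%E.
  by rewrite big_sumType.
(* Coordinates that are never read contribute the factor 1; the others are reindexed along [s]. *)
rewrite (bigID (mem (codom s)))/= [X in (_ * X)%E]big1 ?mule1; last first.
  move=> c /negP cs; rewrite /C; case: pickP => [j /eqP sj|_]; last first.
    by case: c {cs} => i; exact: probability_setT.
  by exfalso; apply: cs; rewrite -sj codom_f.
rewrite (eq_bigl (mem [set s j | j in 'I_n])%SET); last first.
  by move=> c; apply/codomP/imsetP => -[j]; exists j.
rewrite big_imset/=; last by move=> ? ? _ _; exact: sI.
by apply: eq_bigr => j _; rewrite mus// Cs; case: (s j).
Qed.

End product_law_theory.

(** * Tuples with two distinguished end points *)

Definition midord n (i : 'I_n) : 'I_n.+2 := lift ord0 (widen_ord (leqnSn n) i).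

Definition ends T n (a b : T) (q : n.-tuple T) : n.+2.-tuple T :=
  [tuple of a :: rcons q b].

Lemma val_midord n (i : 'I_n) : midord i = i.+1 :> nat.
Proof. by []. Qed.

Variant ord_ends_spec n : 'I_n.+2 -> Type :=
| OrdFirst : ord_ends_spec ord0
| OrdLast : ord_ends_spec ord_max
| OrdMid (i : 'I_n) : ord_ends_spec (midord i).

Lemma ord_endsP n (j : 'I_n.+2) : ord_ends_spec j.
Proof.
case: (unliftP ord0 j) => [k ->|->]; last by constructor.
have [kn|kn] := ltnP k n.
  rewrite (_ : lift _ _ = midord (Ordinal kn)); first by constructor.
  by apply: val_inj.
rewrite (_ : lift _ _ = ord_max); first by constructor.
by apply: val_inj; apply/eqP; rewrite /= /bump/= add1n eqSS eqn_leq -ltnS ltn_ord.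
Qed.

Section tnth_ends.
Context T n (a b : T) (q : n.-tuple T).

Lemma tnth_ends0 : tnth (ends a b q) ord0 = a.
Proof. by []. Qed.

Lemma tnth_ends_max : tnth (ends a b q) ord_max = b.
Proof. by rewrite (tnth_nth a)/= nth_rcons size_tuple ltnn eqxx. Qed.

Lemma tnth_ends_mid i : tnth (ends a b q) (midord i) = tnth q i.
Proof. by rewrite (tnth_nth a)/= nth_rcons size_tuple ltn_ord -tnth_nth. Qed.

End tnth_ends.

Section product_law_ends.
Context {d} {T : measurableType d} {R : realType}.

Lemma measurable_ends n :
  measurable_fun [set: T * (T * n.-tuple T)] (fun z => ends z.1 z.2.1 z.2.2).
Proof.
apply/measurable_fun_tnthP => j; case: (ord_endsP j) => [||i].
- by rewrite (_ : _ \o _ = fst).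
- rewrite (_ : _ \o _ = fst \o snd); first exact: measurableT_comp.
  by apply/funext => z /=; rewrite tnth_ends_max.
- rewrite (_ : _ \o _ = (fun t => tnth t i) \o (snd \o snd)).
    by apply: measurableT_comp; [exact: measurable_tnth|exact: measurableT_comp].
  by apply/funext => z /=; rewrite tnth_ends_mid.
Qed.

Lemma big_ord_ends (V : Type) (idx : V) (op : Monoid.com_law idx) n (F : 'I_n.+2 -> V) :
  \big[op/idx]_(i < n.+2) F i =
  op (F ord0) (op (F ord_max) (\big[op/idx]_(i < n) F (midord i))).
Proof.
rewrite big_ord_recl big_ord_recr/=; congr (op _ _); rewrite Monoid.mulmC.
by congr (op (F _) _); exact: val_inj.
Qed.

Lemma measurable_ends_preimage n (E : set (n.+2.-tuple T)) : measurable E ->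
  measurable ((fun z : T * (T * n.-tuple T) => ends z.1 z.2.1 z.2.2) @^-1` E).
Proof. by move=> mE; rewrite -[X in measurable X]setTI; exact: measurable_ends. Qed.

Lemma xsection_ends n (E : set (n.+2.-tuple T)) a b :
  xsection (xsection ((fun z : T * (T * n.-tuple T) => ends z.1 z.2.1 z.2.2) @^-1` E) a) b =
  [set q | E (ends a b q)].
Proof.
by apply/seteqP; split=> q /= => [/set_mem/set_mem//|Eq]; do 2 apply/mem_set.
Qed.

Lemma measurable_ends_section n (E : set (n.+2.-tuple T)) a b : measurable E ->
  measurable [set q : n.-tuple T | E (ends a b q)].
Proof.
move=> mE; rewrite -xsection_ends.
do 2 apply: measurable_xsection; exact: measurable_ends_preimage.
Qed.

Lemma measurable_product_law_ends n (mu : 'I_n.+2 -> probability T R) E a : measurable E ->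
  measurable_fun setT
    (fun b => product_law (mu \o @midord n) [set q | E (ends a b q)]).
Proof.
move=> mE.
have := measurable_fun_xsection (product_law (mu \o @midord n))
  (measurable_xsection a (measurable_ends_preimage mE)).
apply: eq_measurable_fun => b _ /=.
by rewrite xsection_ends.
Qed.

Lemma measurable_integral_product_law_ends n (mu : 'I_n.+2 -> probability T R) E :
  measurable E ->
  measurable_fun setT (fun a => \int[mu ord_max]_b
    product_law (mu \o @midord n) [set q | E (ends a b q)])%E.
Proof.
move=> mE.
pose Q : probability _ R := (mu ord_max \x product_law (mu \o @midord n))%E.
have := measurable_fun_xsection Q (measurable_ends_preimage mE).
apply: eq_measurable_fun => a _; apply: eq_integral => b _.
by rewrite -xsection_ends.
Qed.

(** Conditioning on the end points: the law is the image under [ends] of a nested product measure,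
    and a product measure is by definition the integral of its sections. *)
Lemma product_law_ends n (mu : 'I_n.+2 -> probability T R) E : measurable E ->
  product_law mu E = (\int[mu ord0]_a \int[mu ord_max]_b
    product_law (mu \o @midord n) [set q | E (ends a b q)])%E.
Proof.
move=> mE.
pose mf := isMeasurableFun.Build _ _ _ _ _ (@measurable_ends n).
pose f : {mfun (T * (T * n.-tuple T))%type >-> n.+2.-tuple T} :=
  HB.pack (fun z : T * (T * n.-tuple T) => ends z.1 z.2.1 z.2.2) mf.
pose Q : probability _ R := (mu ord_max \x product_law (mu \o @midord n))%E.
pose P : probability _ R := (mu ord0 \x Q)%E.
transitivity (P (f @^-1` E)).
  apply: (product_law_unique (m := distribution P f)) => // B mB.
  transitivity (P (f @^-1` box B)); first by [].
  rewrite (_ : _ @^-1` _ = B ord0 `*` (B ord_max `*` box (B \o @midord n))); last first.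
    apply/seteqP; split=> -[a [b q]] /=.
      move=> abqB; split; first exact: (abqB ord0).
      split; first by have := abqB ord_max; rewrite tnth_ends_max.
      by move=> i; have := abqB (midord i); rewrite tnth_ends_mid.
    case=> Ba [Bb Bq] j; case: (ord_endsP j) => [||i] //.
      by rewrite tnth_ends_max.
    by rewrite tnth_ends_mid; exact: (Bq i).
  have mbox : measurable (box (B \o @midord n)).
    by apply: measurable_box => i; exact: mB.
  rewrite big_ord_ends.
  transitivity (mu ord0 (B ord0) * Q (B ord_max `*` box (B \o @midord n)))%E.
    apply: product_measure1E => //; exact: measurableX.
  congr (_ * _)%E.
  transitivity (mu ord_max (B ord_max) * product_law (mu \o @midord n) (box (B \o @midord n)))%E.
    exact: product_measure1E.
  congr (_ * _)%E.
  by apply: product_law_box => i; exact: mB.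
transitivity (\int[mu ord0]_a Q (xsection (f @^-1` E) a))%E; first by [].
apply: eq_integral => a _.
transitivity (\int[mu ord_max]_b
   product_law (mu \o @midord n) (xsection (xsection (f @^-1` E) a) b))%E; first by [].
apply: eq_integral => b _.
by rewrite -xsection_ends.
Qed.

(** Lets the conditional law given the end points be read as a product law on full tuples with
    degenerate end segments, to which the chord argument applies. *)
Lemma product_law_dirac_ends n (mu : 'I_n.+2 -> probability T R) a b E : measurable E ->
  (forall A, measurable A -> mu ord0 A = \d_a A) ->
  (forall A, measurable A -> mu ord_max A = \d_b A) ->
  product_law mu E = product_law (mu \o @midord n) [set q | E (ends a b q)].
Proof.
move=> mE mu0 mu1.
pose P := product_law (mu \o @midord n).
have mg : measurable_fun setT (fun q : n.-tuple T => ends a b q).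
  apply/measurable_fun_tnthP => j; case: (ord_endsP j) => [||i].
  - by rewrite (_ : _ \o _ = cst a).
  - rewrite (_ : _ \o _ = cst b)//.
    by apply/funext => z /=; rewrite tnth_ends_max.
  - rewrite (_ : _ \o _ = (fun t => tnth t i)); first exact: measurable_tnth.
    by apply/funext => z /=; rewrite tnth_ends_mid.
pose mf := isMeasurableFun.Build _ _ _ _ _ mg.
pose f : {mfun n.-tuple T >-> n.+2.-tuple T} := HB.pack (fun q : n.-tuple T => ends a b q) mf.
apply: (product_law_unique (m := distribution P f)) => // B mB.
transitivity (P (f @^-1` box B)); first by [].
rewrite big_ord_ends mu0// mu1// !diracE.
have [aB|aB] := boolP (a \in B ord0); last first.
  rewrite /= mul0e (_ : _ @^-1` _ = set0) ?measure0//.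
  apply/seteqP; split=> q //= /(_ ord0) /=.
  by move/negP: aB; rewrite inE.
have [bB|bB] := boolP (b \in B ord_max); last first.
  rewrite /= mul0e mule0 (_ : _ @^-1` _ = set0) ?measure0//.
  apply/seteqP; split=> q //= /(_ ord_max) /=; rewrite tnth_ends_max.
  by move/negP: bB; rewrite inE.
rewrite /= !mul1e -product_law_box; last by move=> i; exact: mB.
congr (product_law _ _); apply/seteqP; split=> q /= qB => [i|j].
  by have := qB (midord i); rewrite tnth_ends_mid.
move: aB bB; rewrite !inE => aB bB.
case: (ord_endsP j) => [||i] //; first by rewrite tnth_ends_max.
by rewrite tnth_ends_mid; exact: (qB i).
Qed.

(** On a box, a product of two-term sums expands over the subsets [A]; the right-hand side being a
    measure, uniqueness concludes. *)
Lemma product_law_mixture n (mu mu1 mu2 : 'I_n -> probability T R) (p q : 'I_n -> R) :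
  (forall i, 0 <= p i) -> (forall i, 0 <= q i) ->
  (forall i A, measurable A -> mu i A = ((p i)%:E * mu1 i A + (q i)%:E * mu2 i A)%E) ->
  forall E, measurable E -> product_law mu E =
    (\sum_(A : {set 'I_n}) (\prod_i (if i \in A then p i else q i))%:E *
       product_law (fun i => if i \in A then mu1 i else mu2 i) E)%E.
Proof.
move=> p0 q0 muE E mE.
pose W (A : {set 'I_n}) := \prod_i (if i \in A then p i else q i).
have W0 A : 0 <= W A by apply: prodr_ge0 => i _; case: ifP.
pose PA (A : {set 'I_n}) := product_law (fun i => if i \in A then mu1 i else mu2 i).
pose s := enum {: {set 'I_n}}.
(* [msum] is indexed by naturals, so the subsets are enumerated; the default value of [nth] is never
   reached below [size s]. *)
pose m k : {measure set (n.-tuple T) -> \bar R} :=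
  mscale (NngNum (W0 (nth finset.set0 s k))) (PA (nth finset.set0 s k)).
have mE' B : msum m (size s) B = (\sum_(A : {set 'I_n}) (W A)%:E * PA A B)%E.
  rewrite /msum -(big_mkord xpredT (fun k => m k B)) /=.
  rewrite -(big_nth finset.set0 xpredT (fun A => (W A)%:E * PA A B)%E).
  by rewrite big_enum.
rewrite -/(PA _) -mE'; apply: (product_law_unique (m := msum m (size s))) => // B mB.
etransitivity; [exact: mE'|]; under [RHS]eq_bigr do rewrite muE//.
(* Probabilities are finite, which allows the distributive expansion to take place in [R]. *)
have fE (P : probability T R) i : P (B i) = (fine (P (B i)))%:E.
  by rewrite fineK// fin_num_measure.
under [RHS]eq_bigr => i _.
  rewrite (fE (mu1 i)) (fE (mu2 i)) -!EFinM -EFinD.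
  over.
rewrite prodEFin bigA_distr -sumEFin.
apply: eq_big => // A _; rewrite /PA.
rewrite [X in (_ * X)%E](_ : _ =
   \prod_i (if i \in A then mu1 i (B i) else mu2 i (B i)))%E; last first.
  rewrite [LHS]product_law_box//.
  by apply: eq_bigr => i _; case: ifP.
under [X in (_ * X)%E]eq_bigr => i _.
  rewrite (fE (mu1 i)) (fE (mu2 i)) -(fun_if EFin).
  over.
rewrite prodEFin -EFinM -big_split/=; congr (_%:E).
by apply: eq_bigr => i _; case: ifP.
Qed.

End product_law_ends.

(** * Uniform laws on vertical segments *)

Section lebesgue_affine.
Context {R : realType}.
Local Notation mu := (@lebesgue_measure R).

Definition affpath (a b t : R) : R := (1 - t) * a + t * b.

Lemma measurable_affpath (a b : R) :
  measurable_fun [set: measurableTypeR R] (affpath a b : measurableTypeR R -> measurableTypeR R).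
Proof.
by apply: measurable_funD; apply: measurable_funM => //; exact: measurable_funB.
Qed.

(** The rescaled image measure agrees with Lebesgue measure on half-open intervals, which
    characterise it. *)
Lemma lebesgue_measure_affpath (a b : R) (A : set R) : a != b -> measurable A ->
  mu (affpath a b @^-1` A) = (`|b - a|^-1%:E * mu A)%E.
Proof.
move=> ab mA.
have ba0 : 0 < `|b - a| by rewrite normr_gt0 subr_eq0 eq_sym.
have mf := measurable_affpath a b.
pose m0 : {measure set (measurableTypeR R) -> \bar R} :=
  mscale (NngNum (ltW ba0)) (pushforward mu (affpath a b : measurableTypeR R -> measurableTypeR R)).
pose m := m0 mf.
suff H X : ocitv X -> mu X = m X.
  have -> : mu A = m A by apply: lebesgue_measure_unique.
  rewrite /m /m0 /mscale/= muleA -EFinM mulVf ?gt_eqF// mul1e.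
  by [].
move=> [[c e] _ <-] /=.
rewrite /m /m0 /mscale/= /pushforward.
have [ab'|ab'] := ltP a b.
  have d0 : 0 < b - a by lra.
  rewrite (_ : _ @^-1` _ = `](c - a) / (b - a), (e - a) / (b - a)]%classic); last first.
    apply/seteqP; split=> t /=; rewrite !in_itv/= ltr_pdivrMr// ler_pdivlMr// /affpath; lra.
  rewrite !lebesgue_measure_itv/= !lte_fin ltr_pM2r ?invr_gt0// ltrD2r.
  case: ifP => _; last by rewrite mule0.
  by rewrite -!EFinD -EFinM gtr0_norm//; congr (_%:E); field; rewrite gt_eqF.
(* For a decreasing path the preimage of an interval open on the left is open on the right. *)
have d0 : 0 < a - b by rewrite subr_gt0 lt_neqAle eq_sym ab.
rewrite (_ : _ @^-1` _ = `[(a - e) / (a - b), (a - c) / (a - b)[%classic); last first.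
  apply/seteqP; split=> t /=; rewrite !in_itv/= ltr_pdivlMr// ler_pdivrMr// /affpath; lra.
rewrite !lebesgue_measure_itv/= !lte_fin ltr_pM2r ?invr_gt0// ltrD2l ltrN2.
case: ifP => _; last by rewrite mule0.
by rewrite -!EFinD -EFinM ltr0_norm; [congr (_%:E); field; rewrite gt_eqF|lra].
Qed.

Lemma uniform_probE (a b : R) (ab : a < b) (B : set R) : measurable B ->
  uniform_prob ab B = ((b - a)^-1%:E * mu (B `&` `[a, b]))%E.
Proof.
move=> mB; rewrite /uniform_prob integral_uniform_pdf.
rewrite (eq_integral (fun=> (b - a)^-1%:E)); last first.
  by move=> x; rewrite inE/= in_itv/= /uniform_pdf => -[_ ->].
by rewrite integral_cst//=; exact: measurableI.
Qed.

Lemma lebesgue_measure_itv_split (a b c : R) (B : set R) : measurable B -> a <= b <= c ->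
  mu (B `&` `[a, c]) = (mu (B `&` `[a, b]) + mu (B `&` `[b, c]))%E.
Proof.
move=> mB /andP[ab bc].
have -> : mu (B `&` `[b, c]) = mu (B `&` `]b, c]).
  rewrite (_ : `[b, c] = [set b] `|` `]b, c])%classic; last by rewrite setU1itv.
  rewrite setIUr measureU//; [|exact: measurableI..|]; last first.
    apply/seteqP; split => t //= [[_ ->] [_]].
    by rewrite in_itv/= ltxx.
  rewrite [X in (X + _)%E](_ : _ = 0%E) ?add0e//.
  apply/eqP; rewrite eq_le measure_ge0 andbT -(lebesgue_measure_set1 b).
  apply: le_measure; rewrite ?inE//; exact: measurableI.
rewrite -measureU//; [|exact: measurableI..|].
  rewrite -setIUr; congr (mu (_ `&` _)); apply/seteqP; split => t /=; rewrite !in_itv/=.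
    by case: (leP t b) => tb /andP[-> tc]; [left|right].
  by case=> /andP[h1 h2]; apply/andP; split; lra.
apply/seteqP; split => t //= [[_ +] [_]]; rewrite !in_itv/=; lra.
Qed.

End lebesgue_affine.

Section uniform_segment.
Context {R : realType}.
Local Notation mu := (@lebesgue_measure R).
Implicit Types (x a b : R).

(** The endpoints come in either order because pieces below the chord are written from the chord
    downwards. *)
Lemma uniform_vsegment x a b (B : set (R * R)) : a != b -> measurable B ->
  uniform_segment (vsegment x a b) B =
  (`|b - a|^-1%:E * mu ([set y | B (x, y)] `&` `[Num.min a b, Num.max a b]))%E.
Proof.
move=> ab mB.
have mBx : measurable [set y : measurableTypeR R | B (x, y)].
  by have := measurable_xsection x mB; rewrite xsectionE.
transitivity (uniform_prob (@ltr01 R) (affpath a b @^-1` [set y | B (x, y)])).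
  congr (uniform_prob _ _); apply/seteqP; split=> t /=;
  by rewrite /segment_path/= /affpath -mulrDl subrK mul1r.
have mP : measurable
  (affpath a b @^-1` [set y : measurableTypeR R | B (x, y)] : set (measurableTypeR R)).
  by rewrite -[X in measurable X]setTI; exact: measurable_affpath.
rewrite uniform_probE// subr0 invr1 mul1e -lebesgue_measure_affpath//; last first.
  exact: measurableI.
congr (mu _); rewrite preimage_setI; congr (_ `&` _).
apply/seteqP; split=> t /=; rewrite !in_itv/= /affpath ge_min le_max.
  move=> t01; case: (leP a b) => ab'.
    by apply/andP; split; apply/orP; [left|right]; nra.
  by apply/andP; split; apply/orP; [right|left]; nra.
have ba : a < b \/ b < a by apply/orP; rewrite -neq_lt.
by move=> /andP[/orP[h1|h1] /orP[h2|h2]]; apply/andP; split; case: ba => ba; nra.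
Qed.

Lemma uniform_vsegment0 x a (B : set (R * R)) : measurable B ->
  uniform_segment (vsegment x a a) B = \d_(x, a) B.
Proof.
move=> mB; rewrite diracE.
transitivity (uniform_prob (@ltr01 R) [set t | B (x, a)]).
  congr (uniform_prob _ _); apply/seteqP; split=> t /=;
  by rewrite /segment_path/= -!mulrDl subrK !mul1r.
have [Bxa|Bxa] := boolP ((x, a) \in B).
  rewrite (_ : [set t | B (x, a)] = setT) ?probability_setT//.
  by apply/seteqP; split=> // t _ /=; rewrite inE in Bxa.
rewrite (_ : [set t | B (x, a)] = set0) ?measure0//.
by apply/seteqP; split=> // t /= Bxa'; move/negP: Bxa; rewrite inE.
Qed.

(** Both pieces start at the cut [u], so that a shear sending [u] to height 0 makes them teeth of a
    comb. *)
Lemma uniform_vsegment_split x a u b (B : set (R * R)) : measurable B ->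
  a < b -> a <= u <= b ->
  uniform_segment (vsegment x a b) B =
   (((b - u) / (b - a))%:E * uniform_segment (vsegment x u b) B +
    ((u - a) / (b - a))%:E * uniform_segment (vsegment x u a) B)%E.
Proof.
move=> mB ab aub.
have mBx : measurable [set y : measurableTypeR R | B (x, y)].
  by have := measurable_xsection x mB; rewrite xsectionE.
have scal (r s : R) (e : \bar R) : 0 < r -> ((r * s)%:E * (r^-1%:E * e) = s%:E * e)%E.
  by move=> r0; rewrite muleA -EFinM; congr (_%:E * _)%E; field; rewrite gt_eqF.
have d0 : 0 < b - a by lra.
rewrite uniform_vsegment ?lt_eqF// min_l ?max_r ?(ltW ab)// gtr0_norm//.
(* At an extreme cut one piece is a point, where the density formula fails, but its weight is 0. *)
have [ub|ub] := eqVneq u b.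
  rewrite ub subrr mul0r mul0e add0e divff ?gt_eqF// mul1e.
  rewrite uniform_vsegment ?gt_eqF// min_r ?max_l ?(ltW ab)// distrC gtr0_norm//.
have [ua|ua] := eqVneq u a.
  rewrite ua subrr mul0r mul0e adde0 divff ?gt_eqF// mul1e.
  by rewrite uniform_vsegment ?lt_eqF// min_l ?max_r ?(ltW ab)// gtr0_norm.
have ub' : u < b by rewrite lt_neqAle ub; case/andP: aub.
have au' : a < u by rewrite lt_neqAle eq_sym ua; case/andP: aub.
rewrite !uniform_vsegment// (min_l (ltW ub')) (max_r (ltW ub')).
rewrite (min_r (ltW au')) (max_l (ltW au')) gtr0_norm ?subr_gt0//.
rewrite (distrC a u) gtr0_norm ?subr_gt0// !scal ?subr_gt0//.
rewrite -ge0_muleDr//; congr (_ * _)%E.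
by rewrite addeC; exact: lebesgue_measure_itv_split.
Qed.

Lemma uniform_segment_affine (phi : R * R -> R * R) (S S' : segment R) B :
  (forall t, segment_path S' t = phi (segment_path S t)) ->
  uniform_segment S' B = uniform_segment S (phi @^-1` B).
Proof.
by move=> SS'; congr (uniform_prob _ _); apply/seteqP; split=> t /=; rewrite SS'.
Qed.

Lemma uniform_segment_as (S : segment R) B : measurable B ->
  (forall t, 0 <= t <= 1 -> B (segment_path S t)) -> uniform_segment S B = 1%E.
Proof.
move=> mB SB; rewrite /uniform_segment /distribution /pushforward/= /uniform_prob.
rewrite integral_uniform_pdf1// => t /=; rewrite in_itv/=; exact: SB.
Qed.

Lemma integral_uniform_vsegment x a b (f : R * R -> \bar R) : a < b ->
  measurable_fun setT f -> (forall z, 0 <= f z)%E ->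
  (\int[uniform_segment (vsegment x a b)]_z f z =
   (b - a)^-1%:E * \int[mu]_(y in `[a, b]) f (x, y))%E.
Proof.
move=> ab mf f0.
have mx : measurable_fun setT (fun y : measurableTypeR R => (x, y) : R * R).
  exact: measurable_fun_pair.
transitivity (\int[pushforward (uniform_prob ab)
  (fun y : measurableTypeR R => (x, y) : R * R)]_z f z)%E.
  apply: eq_measure_integral => // B mB _.
  etransitivity; first by apply: uniform_vsegment; rewrite ?lt_eqF.
  rewrite min_l ?max_r ?(ltW ab)// gtr0_norm ?subr_gt0//.
  rewrite [RHS]uniform_probE//.
  by rewrite -[X in measurable X]setTI; exact: mx.
rewrite ge0_integral_pushforward//=.
rewrite preimage_setT integral_uniform//.
exact: measurableT_comp.
Qed.

End uniform_segment.

(** * Combs *)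

Section shear.
Context {R : realType}.

(* For e = 1 (resp. -1) and a chord of height c + m t, this puts the chord on the
   axis and the points above (resp. below) it in the upper half-plane. *)
Definition shear (c m e : R) (z : R * R) : R * R := (z.1, e * (z.2 - (c + z.1 * m))).

Lemma shear_mix c m e t a b :
  shear c m e (mix t a b) = mix t (shear c m e a) (shear c m e b).
Proof. by rewrite /shear /mix/=; congr (_, _); ring. Qed.

Lemma measurable_shear c m e : measurable_fun setT (shear c m e).
Proof.
apply: measurable_fun_pair => //.
by apply: measurable_funM => //; apply: measurable_funB => //;
  apply: measurable_funD => //; exact: measurable_funM.
Qed.

Lemma segment_path_shear c m e t (S : segment R) :
  segment_path (shear c m e S.1, shear c m e S.2) t = shear c m e (segment_path S t).
Proof. by rewrite /segment_path /shear/=; congr (_, _); ring. Qed.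

Lemma convex_position_shear n c m e (p : n.-tuple (R * R)) : e != 0 ->
  convex_position [tuple shear c m e (tnth p i) | i < n] <-> convex_position p.
Proof.
move=> e0; split.
  apply: (convex_position_affine (@shear_mix c m e)) => i.
  by rewrite tnth_mktuple.
pose unshear (z : R * R) : R * R := (z.1, z.2 / e + (c + z.1 * m)).
apply: (convex_position_affine (phi := unshear)) => [t a b|i].
  by rewrite /unshear /mix/=; congr (_, _); field.
rewrite tnth_mktuple /unshear /shear/= mulrC mulKf// subrK.
by rewrite -surjective_pairing.
Qed.

Lemma convex_position_prob_shear n c m e (S : n.-tuple (segment R)) : e != 0 ->
  convex_position_prob [tuple (shear c m e (tnth S i).1, shear c m e (tnth S i).2) | i < n]
  = convex_position_prob S.
Proof.
move=> e0; congr fine.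
rewrite (product_law_map (mu := fun j => uniform_segment (tnth S j))
    (measurable_shear c m e) _ (@measurable_convex_position R n)); last first.
  move=> i A mA; rewrite tnth_mktuple; apply: uniform_segment_affine => t.
  exact: segment_path_shear.
congr (product_law _ _); apply/seteqP; split=> p /= hp.
  by move: hp; rewrite convex_position_shear.
by rewrite convex_position_shear.
Qed.

End shear.

Lemma probability_setI_full d (T : measurableType d) (R : realType)
    (P : probability T R) (Z X Y : set T) :
  measurable Z -> measurable X -> measurable Y -> P Z = 1%E ->
  X `&` Z = Y `&` Z -> P X = P Y.
Proof.
move=> mZ mX mY PZ XY.
have h W : measurable W -> P W = P (W `&` Z).
  move=> mW; rewrite (measureDI P mW mZ) [X in (X + _)%E](_ : _ = 0%E) ?add0e//.
  apply/eqP; rewrite eq_le measure_ge0 andbT.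
  have <- : P (~` Z) = 0%E by rewrite probability_setC// PZ subee.
  apply: le_measure; rewrite ?inE; [exact: measurableD|exact: measurableC|by move=> t []].
by rewrite (h X)// (h Y)// XY.
Qed.

(** * Comb positions as indices of the whole family *)

Section comb_index.
Context (N : nat).
Implicit Types A : {set 'I_N.+2}.

(** Both end indices are included, so for [A] made of inner indices the ranges for [A] and for its
    complement share exactly the two ends. *)
Definition comb_index A : 'I_(#|A|.+2) -> 'I_N.+2 :=
  tnth (ends ord0 ord_max (enum_tuple A)).

Lemma inner_indicesE (j : 'I_N.+2) :
  (j \in inner_indices N) = (j != ord0) && (j != ord_max).
Proof.
rewrite inE lt0n -ltnS; congr (_ && _).
by rewrite ltn_neqAle -ltnS ltn_ord andbT.
Qed.

Lemma mem_comb_index A j :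
  range (@comb_index A) j <-> (j \in A) || (j \notin inner_indices N).
Proof.
split=> [[i _ <-]|].
  case: (ord_endsP i) => [||k]; rewrite /comb_index.
  - by rewrite tnth_ends0 inner_indicesE eqxx orbT.
  - by rewrite tnth_ends_max inner_indicesE eqxx andbF orbT.
  - by rewrite tnth_ends_mid -mem_enum mem_tnth.
have [->|j0] := eqVneq j ord0; first by exists ord0.
have [->|jm] := eqVneq j ord_max.
  by exists ord_max => //; rewrite /comb_index tnth_ends_max.
rewrite inner_indicesE j0 jm orbF -mem_enum => jA.
have /tnthP[k ->] : j \in enum_tuple A by [].
by exists (midord k) => //; rewrite /comb_index tnth_ends_mid.
Qed.

Lemma comb_index_inj A : A \subset inner_indices N -> injective (@comb_index A).
Proof.
move=> /fintype.subsetP AI.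
suff : uniq (ends ord0 ord_max (enum_tuple A)).
  by move=> /tuple_uniqP; exact.
rewrite /= mem_rcons rcons_uniq enum_uniq !inE !mem_enum andbT.
apply/andP; split.
  by apply/norP; split=> //; apply/negP => /AI; rewrite inner_indicesE eqxx.
by apply/negP => /AI; rewrite inner_indicesE eqxx andbF.
Qed.

Lemma tnth_comb_on (R : realType) A (x h : 'I_N.+2 -> R) i :
  x ord0 = 0 -> x ord_max = 1 -> A \subset inner_indices N ->
  tnth (comb_on A x h) i = vsegment (x (comb_index i)) 0
    (if comb_index i \in inner_indices N then h (comb_index i) else 0).
Proof.
move=> x0 x1 /fintype.subsetP AI; rewrite (tnth_nth (vsegment 0 0 0)).
case: (ord_endsP i) => [||k]; rewrite /comb_index.
- by rewrite tnth_ends0 inner_indicesE eqxx/= x0.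
- rewrite tnth_ends_max inner_indicesE eqxx andbF/= x1.
  by rewrite nth_rcons !size_map -cardE ltnn eqxx.
- rewrite tnth_ends_mid AI; last by rewrite -mem_enum mem_tnth.
  rewrite /= nth_rcons !size_map -cardE ltn_ord.
  rewrite -map_comp (nth_map ord0); last by rewrite -cardE; exact: ltn_ord.
  by rewrite (tnth_nth ord0).
Qed.

End comb_index.

(** * Decoupling of the two sides of a fixed chord *)

Section sides.
Context {R : realType} {N : nat} (x : 'I_N.+2 -> R).
Hypotheses (x0 : x ord0 = 0) (x1 : x ord_max = 1).
Hypothesis xlt : forall i j : 'I_N.+2, (i < j)%N -> x i < x j.
Variables (u0 u1 : R) (lp lm : 'I_N.+2 -> R).

Let u (j : 'I_N.+2) : R := u0 + x j * (u1 - u0).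

Hypothesis lpu : forall j, j \in inner_indices N -> u j <= lp j.
Hypothesis lmu : forall j, j \in inner_indices N -> - lm j <= u j.

Implicit Types A B : {set 'I_N.+2}.

(** The piece of each segment on the side prescribed by [A], written from the chord outwards; an end
    index gives the point of the chord. *)
Definition side_segment A (j : 'I_N.+2) : segment R := vsegment (x j) (u j)
  (if j \in A then lp j else if j \in inner_indices N then - lm j else u j).

Lemma abscissa_gt0_lt1 j : j \in inner_indices N -> 0 < x j < 1.
Proof.
rewrite inE => /andP[j0 jN]; rewrite -x0 -x1; apply/andP; split; apply: xlt => //.
Qed.

Lemma abscissa_inj : injective x.
Proof.
move=> i j xij; apply: val_inj; apply/eqP; rewrite eqn_leq; apply/andP; split;
by rewrite leqNgt; apply/negP => /xlt; rewrite xij ltxx.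
Qed.

Lemma convex_position_prob_upper A : A \subset inner_indices N ->
  convex_position_prob (comb_on A x (fun j => lp j - u j)) =
  convex_position_prob [tuple side_segment A (comb_index i) | i < #|A|.+2].
Proof.
move=> AI; rewrite -[RHS](convex_position_prob_shear u0 (u1 - u0) _ (oner_neq0 R)).
congr convex_position_prob; apply: eq_from_tnth => i; rewrite tnth_comb_on// !tnth_mktuple.
rewrite /shear /side_segment /vsegment/= -/(u _) !mul1r subrr.
have : range (@comb_index N A) (comb_index i) by exists i.
rewrite mem_comb_index => /orP[iA|iN].
  by rewrite iA (fintype.subsetP AI).
have /negbTE-> : comb_index i \notin A.
  by apply: contra iN; exact: (fintype.subsetP AI).
by rewrite (negbTE iN) subrr.
Qed.

Lemma convex_position_prob_lower A : A \subset inner_indices N ->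
  convex_position_prob (comb_on (inner_indices N :\: A) x (fun j => lm j + u j)) =
  convex_position_prob
    [tuple side_segment A (comb_index i) | i < #|inner_indices N :\: A|.+2].
Proof.
have N1 : (-1 : R) != 0 by rewrite oppr_eq0 oner_eq0.
move=> AI; rewrite -[RHS](convex_position_prob_shear u0 (u1 - u0) _ N1).
congr convex_position_prob; apply: eq_from_tnth => i.
rewrite tnth_comb_on ?subsetDl// !tnth_mktuple.
rewrite /shear /side_segment /vsegment/= -/(u _) !mulN1r subrr oppr0.
have : range (@comb_index N (inner_indices N :\: A)) (comb_index i) by exists i.
rewrite mem_comb_index inE => /orP[/andP[/negbTE-> iN]|iN].
  by rewrite iN -opprD opprK.
have /negbTE-> : comb_index i \notin A.
  by apply: contra iN; exact: (fintype.subsetP AI).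
by rewrite (negbTE iN) subrr oppr0.
Qed.

(** Closed and easily measurable supports for the upper points; at an end index they pin the point
    to the chord exactly. [below] is the counterpart for the lower points. *)
Let above (j : 'I_N.+2) : set (R * R) :=
  [set z | [&& z.1 == x j, u j <= z.2 & (j \in inner_indices N) || (z.2 == u j)]].
Let below (j : 'I_N.+2) : set (R * R) :=
  [set z | [&& z.1 == x j, z.2 <= u j & (j \in inner_indices N) || (z.2 == u j)]].

Let measurable_above j : measurable (above j).
Proof.
apply: measurable_bool; apply: measurable_and; first exact: measurable_fun_eqr.
apply: measurable_and; first exact: measurable_fun_ler.
by apply: measurable_or => //; exact: measurable_fun_eqr.
Qed.

Let measurable_below j : measurable (below j).
Proof.
apply: measurable_bool; apply: measurable_and; first exact: measurable_fun_eqr.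
apply: measurable_and; first exact: measurable_fun_ler.
by apply: measurable_or => //; exact: measurable_fun_eqr.
Qed.

Let above_as A j : A \subset inner_indices N -> (j \in A) || (j \notin inner_indices N) ->
  uniform_segment (side_segment A j) (above j) = 1%E.
Proof.
move=> AI jA; apply: uniform_segment_as => // t t01.
rewrite /segment_path /side_segment /above/= -mulrDl subrK mul1r eqxx/=.
case/orP: jA => [jA|jN].
  have jI := fintype.subsetP AI _ jA.
  by rewrite jA jI/= andbT; have := lpu jI; nra.
rewrite (negbTE jN) (_ : j \in A = false); last first.
  by apply: contraNF jN; exact: (fintype.subsetP AI).
by rewrite -mulrDl subrK mul1r lexx eqxx.
Qed.

Let below_as A j : A \subset inner_indices N -> j \notin A ->
  uniform_segment (side_segment A j) (below j) = 1%E.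
Proof.
move=> AI jA; apply: uniform_segment_as => // t t01.
rewrite /segment_path /side_segment /below/= -mulrDl subrK mul1r eqxx/= (negbTE jA).
have [jI|jN] := boolP (j \in inner_indices N).
  by rewrite andbT; have := lmu jI; nra.
by rewrite -mulrDl subrK mul1r lexx eqxx.
Qed.

(** Shearing the three tuples by the same map puts the chord on the axis, the setting of
    [convex_position_chord]. *)
Lemma convex_position_sides A (p : N.+2.-tuple (R * R))
    (pf : #|A|.+2.-tuple (R * R)) (pg : #|inner_indices N :\: A|.+2.-tuple (R * R)) :
  A \subset inner_indices N ->
  (forall i, tnth pf i = tnth p (comb_index i)) ->
  (forall i, tnth pg i = tnth p (comb_index i)) ->
  (forall i, above (comb_index i) (tnth pf i)) ->
  (forall i, below (comb_index i) (tnth pg i)) ->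
  convex_position p <-> convex_position pf /\ convex_position pg.
Proof.
move=> AI pfE pgE pfA pgB.
pose B := inner_indices N :\: A.
have BI : B \subset inner_indices N by exact: subsetDl.
rewrite -(@convex_position_shear _ _ u0 (u1 - u0) 1 p) ?oner_eq0//.
rewrite -(@convex_position_shear _ _ u0 (u1 - u0) 1 pf) ?oner_eq0//.
rewrite -(@convex_position_shear _ _ u0 (u1 - u0) 1 pg) ?oner_eq0//.
have rA j : range (@comb_index N A) j -> above j (tnth p j).
  by move=> [i _ <-]; rewrite -pfE.
have rB j : range (@comb_index N B) j -> below j (tnth p j).
  by move=> [i _ <-]; rewrite -pgE.
have rAB j : range (@comb_index N A) j \/ range (@comb_index N B) j.
  rewrite !mem_comb_index !inE.
  by case: (j \in A); case: (1 <= j <= N)%N; [left|left|right|left].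
have px j : (tnth p j).1 = x j.
  by case: (rAB j) => [/rA|/rB] /and3P[/eqP].
have pend j : j \notin inner_indices N -> tnth p j = (x j, u j).
  move=> jN; have /rA/and3P[/eqP <- _] : range (@comb_index N A) j.
    by rewrite mem_comb_index jN orbT.
  by rewrite (negbTE jN)/= => /eqP <-; rewrite -surjective_pairing.
have endN : (ord0 : 'I_N.+2) \notin inner_indices N by rewrite inner_indicesE eqxx.
have endM : (ord_max : 'I_N.+2) \notin inner_indices N.
  by rewrite inner_indicesE eqxx andbF.
apply: (@convex_position_chord _ _ _ _ _ ord0 ord_max (@comb_index N A) (@comb_index N B)).
- exact: comb_index_inj.
- exact: comb_index_inj.
- by move=> i; rewrite !tnth_mktuple pfE.
- by move=> i; rewrite !tnth_mktuple pgE.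
- by rewrite tnth_mktuple pend// /shear/= -/(u _) subrr mulr0 x0.
- by rewrite tnth_mktuple pend// /shear/= -/(u _) subrr mulr0 x1.
- move=> j j0 jm; rewrite tnth_mktuple /= px.
  by apply: abscissa_gt0_lt1; rewrite inner_indicesE j0 jm.
- by move=> i j; rewrite !tnth_mktuple /= !px => /abscissa_inj.
- by rewrite mem_comb_index endN orbT.
- by rewrite mem_comb_index endM orbT.
- by rewrite mem_comb_index endN orbT.
- by rewrite mem_comb_index endM orbT.
- by move=> j /rA /and3P[_ pu _]; rewrite tnth_mktuple /= px mul1r subr_ge0.
- by move=> j /rB /and3P[_ pu _]; rewrite tnth_mktuple /= px mul1r subr_le0.
- exact: rAB.
Qed.

(** The upper and lower families are drawn independently, each with its own copy of the end points;
    these copies coincide almost surely, so merging the families recovers the whole law. *)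
Lemma product_law_sides A : A \subset inner_indices N ->
  product_law (fun j => uniform_segment (side_segment A j))
    [set p | convex_position p] =
  (convex_position_prob (comb_on A x (fun j => lp j - u j)) *
   convex_position_prob (comb_on (inner_indices N :\: A) x (fun j => lm j + u j)))%:E.
Proof.
move=> AI; rewrite convex_position_prob_upper// convex_position_prob_lower//.
set B := inner_indices N :\: A.
have BI : B \subset inner_indices N by exact: subsetDl.
pose SA := [tuple side_segment A (comb_index i) | i < #|A|.+2].
pose SB := [tuple side_segment A (comb_index i) | i < #|B|.+2].
pose PA := product_law (fun i => uniform_segment (tnth SA i)).
pose PB := product_law (fun i => uniform_segment (tnth SB i)).
(* The upper family is read first, hence it supplies the end points; the last default is excluded by
   [hs]. *)
pose s (j : 'I_N.+2) : 'I_(#|A|.+2) + 'I_(#|B|.+2) :=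
  if [pick i | comb_index i == j] is Some i then inl i else
  if [pick i | comb_index i == j] is Some i then inr i else inl ord0.
pose h c := match c with inl i => @comb_index N A i | inr i => @comb_index N B i end.
have hs : cancel s h.
  move=> j; rewrite /s; case: pickP => [i /eqP//|nA]; case: pickP => [i /eqP//|nB].
  exfalso.
  have : range (@comb_index N A) j \/ range (@comb_index N B) j.
    rewrite !mem_comb_index !inE.
    by case: (j \in A); case: (1 <= j <= N)%N; [left|left|right|left].
  by case=> -[i _ /eqP]; [rewrite nA|rewrite nB].
pose merge (z : #|A|.+2.-tuple (R * R) * #|B|.+2.-tuple (R * R)) : N.+2.-tuple (R * R) :=
  [tuple match s j with inl i => tnth z.1 i | inr i => tnth z.2 i end | j < N.+2].
have mC n := @measurable_convex_position R n.
transitivity ((PA \x PB)%E (merge @^-1` [set p | convex_position p])).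
  apply: (product_law_merge (can_inj hs)); last exact: mC.
  move=> j D mD; have := hs j; case: (s j) => i /= <-; by rewrite tnth_mktuple.
(* The almost sure event on which every point is on its side and the ends are on the chord; the
   equivalence of convex positions is only used there. *)
pose Z := box (fun i => above (@comb_index N A i)) `*` box (fun i => below (@comb_index N B i)).
have mbA : measurable (box (fun i => above (@comb_index N A i))).
  by apply: measurable_box => i; exact: measurable_above.
have mbB : measurable (box (fun i => below (@comb_index N B i))).
  by apply: measurable_box => i; exact: measurable_below.
transitivity ((PA \x PB)%E ([set p | convex_position p] `*` [set p | convex_position p])).
  apply: (@probability_setI_full _ _ _ (PA \x PB)%E Z).
  - exact: measurableX.
  - by rewrite -[X in measurable X]setTI; apply: (@measurable_merge _ _ _ _ _ s) => //; exact: mC.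
  - by apply: measurableX; exact: mC.
  - transitivity (PA (box (fun i => above (@comb_index N A i))) *
                  PB (box (fun i => below (@comb_index N B i))))%E.
      exact: product_measure1E.
    rewrite [X in (X * _)%E](_ : _ = 1%E) ?[X in (_ * X)%E](_ : _ = 1%E) ?mule1//.
      rewrite [LHS]product_law_box; last by move=> i; exact: measurable_below.
      apply: big1 => i _; rewrite tnth_mktuple; apply: below_as => //.
      have : range (@comb_index N B) (comb_index i) by exists i.
      rewrite mem_comb_index inE => /orP[/andP[]//|].
      by apply: contra; exact: (fintype.subsetP AI).
    rewrite [LHS]product_law_box; last by move=> i; exact: measurable_above.
    apply: big1 => i _; rewrite tnth_mktuple; apply: above_as => //.
    by rewrite -mem_comb_index; exists i.
  - have mergeP z : Z z -> convex_position (merge z) <->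
        convex_position z.1 /\ convex_position z.2.
      move=> [zA zB].
      apply: (convex_position_sides AI) => // i.
        rewrite tnth_mktuple; have := hs (comb_index i); rewrite /s.
        case: pickP => [k /eqP/(comb_index_inj AI)->//|/(_ i)]; by rewrite eqxx.
      rewrite tnth_mktuple /s.
      (* An index in both ranges is an end, where on [Z] the two copies are the same point of the
         chord. *)
      case: pickP => [k /eqP ki|_].
        have iN : comb_index i \notin inner_indices N.
          have : range (@comb_index N B) (comb_index i) by exists i.
          have : range (@comb_index N A) (comb_index i) by exists k.
          rewrite !mem_comb_index /B !inE.
          by case: (comb_index i \in A) => /=; case: (0 < _)%N => /=; case: (_ <= N)%N.
        have /and3P[/eqP b1 _] := zB i; rewrite (negbTE iN)/= => /eqP b2.
        have /and3P[/eqP a1 _] := zA k; rewrite ki (negbTE iN)/= => /eqP a2.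
        rewrite [LHS]surjective_pairing [RHS]surjective_pairing b1 b2.
        by rewrite a1 a2 ki.
      case: pickP => [k /eqP/(comb_index_inj BI)->//|/(_ i)]; by rewrite eqxx.
    apply/seteqP; split=> z [] /= h1 h2; split=> //; first exact/mergeP.
    exact/mergeP.
transitivity (PA [set p | convex_position p] * PB [set p | convex_position p])%E.
  by apply: product_measure1E; exact: mC.
by rewrite EFinM; congr (_ * _)%E; apply/esym/fineK; apply: fin_num_measure; exact: mC.
Qed.

End sides.

(** The mixture runs over all subsets of the full index set; weights 0 and 1 at the ends kill every
    subset containing an end. *)
Lemma prod_inner (R : comPzRingType) N (A : {set 'I_N.+2}) (p q : 'I_N.+2 -> R) :
  \prod_j (if j \in A then (if j \in inner_indices N then p j else 0)
           else (if j \in inner_indices N then q j else 1)) =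
  if A \subset inner_indices N then
    (\prod_(j in A) p j) * \prod_(j in inner_indices N :\: A) q j else 0.
Proof.
case: ifPn => [/fintype.subsetP AI|/subsetPn[j jA jI]]; last first.
  by rewrite (bigD1 j)//= jA (negbTE jI) mul0r.
rewrite (bigID (mem A))/=; congr (_ * _).
  by apply: eq_bigr => j jA; rewrite jA AI.
rewrite (bigID (mem (inner_indices N)))/= [X in _ * X]big1 ?mulr1; last first.
  by move=> j /andP[/negbTE-> /negbTE->].
apply: eq_big => [j|j /andP[/negbTE-> ->]//].
by rewrite [in RHS]inE.
Qed.

(** * Conditional probability given the chord *)

Section chord.
Context {R : realType} {N : nat} (x : 'I_N.+2 -> R).
Hypotheses (x0 : x ord0 = 0) (x1 : x ord_max = 1).
Hypothesis xlt : forall i j : 'I_N.+2, (i < j)%N -> x i < x j.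
Variables (u0 u1 : R) (lp lm : 'I_N.+2 -> R).

Let u (j : 'I_N.+2) : R := u0 + x j * (u1 - u0).

Hypothesis lpu : forall j, j \in inner_indices N -> u j <= lp j.
Hypothesis lmu : forall j, j \in inner_indices N -> - lm j <= u j.
Hypothesis w0 : forall j, j \in inner_indices N -> 0 < lp j + lm j.

Lemma product_law_chord :
  product_law (fun j => uniform_segment
      (if j \in inner_indices N then vsegment (x j) (- lm j) (lp j)
       else vsegment (x j) (u j) (u j))) [set p | convex_position p] =
  (\sum_(A : {set 'I_N.+2} | A \subset inner_indices N)
    (\prod_(j in A) ((lp j - u j) / (lp j + lm j)) *
     \prod_(j in inner_indices N :\: A) ((lm j + u j) / (lp j + lm j)) *
     convex_position_prob (comb_on A x (fun j => lp j - u j)) *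
     convex_position_prob (comb_on (inner_indices N :\: A) x (fun j => lm j + u j))))%:E.
Proof.
pose p j := if j \in inner_indices N then (lp j - u j) / (lp j + lm j) else 0.
pose q j := if j \in inner_indices N then (lm j + u j) / (lp j + lm j) else 1.
rewrite (@product_law_mixture _ _ _ _ _
  (fun j => uniform_segment (vsegment (x j) (u j) (lp j)))
  (fun j => uniform_segment (vsegment (x j) (u j)
     (if j \in inner_indices N then - lm j else u j))) p q); last 4 first.
- move=> j; rewrite /p; case: ifPn => // jI.
  by rewrite divr_ge0 ?(ltW (w0 jI))// subr_ge0 lpu.
- move=> j; rewrite /q; case: ifPn => // jI.
  by rewrite divr_ge0 ?(ltW (w0 jI))// -lerBlDl sub0r lmu.
- move=> j B mB; rewrite /p /q; case: ifPn => jI; last by rewrite mul0e add0e mul1e.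
  rewrite (@uniform_vsegment_split _ _ _ (u j))//; first by rewrite opprK [u j + _]addrC.
    by have := w0 jI; lra.
  by rewrite lmu ?lpu.
- exact: measurable_convex_position.
rewrite -sumEFin [RHS]big_mkcond; apply: eq_bigr => A _.
rewrite prod_inner; case: ifPn => AI; last by rewrite mul0e.
rewrite -[in RHS]mulrA [RHS]EFinM; congr (_ * _)%E.
rewrite -(product_law_sides x0 x1 xlt lpu lmu AI).
apply: eq_product_law => [j B mB|]; last exact: measurable_convex_position.
by rewrite /side_segment; case: ifP.
Qed.

End chord.

(** * Integration over the heights of the end points *)

Theorem proposition16 (R : realType) (N : nat) (hN : (1 <= N)%N)
  (x : 'I_N.+2 -> R) (hx0 : x ord0 = 0) (hx1 : x ord_max = 1)
  (hx : forall i j : 'I_N.+2, (i < j)%N -> x i < x j)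
  (L : R -> R) (hL : affine_on `[0, 1] L)
  (hL0 : 0 < L (x ord0)) (hL1 : 0 < L (x ord_max))
  (lam : 'I_N.+2 -> R) (hlam : forall j, 0 <= lam j)
  (hlam0 : lam ord0 = 0) (hlam1 : lam ord_max = 0)
  (hp : forall j : nat, (1 <= j <= N)%N -> 0 <= slope_drop x lam j)
  (beta : 'I_N.+2 -> R) (hbeta : Compa x lam beta) :
  let ellp (j : 'I_N.+2) := L (x j) + lam j + beta j in
  let ellm (j : 'I_N.+2) := L (x j) + lam j - beta j in
  let w (j : 'I_N.+2) := ellp j + ellm j in
  let V := [tuple vsegment (x j) (- ellm j) (ellp j) | j < N.+2] in
  let u (u0 u1 : R) (j : 'I_N.+2) := u0 + x j * (u1 - u0) in
  ((convex_position_prob V)%:E =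
   \int[lebesgue_measure]_(u0 in `[(- L (x ord0))%R, (L (x ord0))%R])
   \int[lebesgue_measure]_(u1 in `[(- L (x ord_max))%R, (L (x ord_max))%R])
     ((\sum_(A : {set 'I_N.+2} | A \subset inner_indices N)
        (\prod_(j in A) ((ellp j - u u0 u1 j) / w j) *
         \prod_(j in inner_indices N :\: A) ((ellm j + u u0 u1 j) / w j) *
         convex_position_prob
           (comb_on A x (fun j => ellp j - u u0 u1 j)) *
         convex_position_prob
           (comb_on (inner_indices N :\: A) x (fun j => ellm j + u u0 u1 j))))
      / (w ord0 * w ord_max))%R%:E)%E.
Proof.
move=> ellp ellm w V u.
case: hbeta => beta0 beta1 blam _.
have x01 j : 0 <= x j <= 1.
  have [/(abscissa_gt0_lt1 hx0 hx1 hx)|] := boolP (j \in inner_indices N).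
    by move=> /andP[/ltW-> /ltW->].
  rewrite inner_indicesE negb_and !negbK => /orP[]/eqP->.
    by rewrite hx0 lexx ler01.
  by rewrite hx1 lexx ler01.
(* As [L] is affine, it interpolates its end values exactly as the chord [u] does. *)
have LE j : L (x j) = L (x ord0) + x j * (L (x ord_max) - L (x ord0)).
  case: hL => c [e Lce].
  by rewrite !Lce ?hx0 ?hx1/= ?in_itv/= ?lexx ?ler01//; ring.
have Lpos j : 0 < L (x j) by rewrite LE; have := x01 j; nra.
pose P0 := product_law (fun j => uniform_segment (tnth V j)).
pose E := [set p : N.+2.-tuple (R * R) | convex_position p].
have mE : measurable E by exact: measurable_convex_position.
(* [H a b] is the conditional probability of convex position given the end points [a] and [b]. *)
pose H (a b : R * R) := product_law
  ((fun j => uniform_segment (tnth V j)) \o @midord N) [set q | E (ends a b q)].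
pose S (u0 u1 : R) := \sum_(A : {set 'I_N.+2} | A \subset inner_indices N)
        (\prod_(j in A) ((ellp j - u u0 u1 j) / w j) *
         \prod_(j in inner_indices N :\: A) ((ellm j + u u0 u1 j) / w j) *
         convex_position_prob
           (comb_on A x (fun j => ellp j - u u0 u1 j)) *
         convex_position_prob
           (comb_on (inner_indices N :\: A) x (fun j => ellm j + u u0 u1 j))).
have HS u0 u1 : u0 \in `[- L (x ord0), L (x ord0)] ->
    u1 \in `[- L (x ord_max), L (x ord_max)] -> H (x ord0, u0) (x ord_max, u1) = (S u0 u1)%:E.
  rewrite !in_itv/= => u0L u1L.
  (* Bounds at the two ends propagate by interpolation. With [|beta j| <= lam j] they give [- ellm j
     <= - L (x j) <= u j <= L (x j) <= ellp j]: the chord meets every segment. *)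
  have uL j : - L (x j) <= u u0 u1 j <= L (x j).
    rewrite LE /u; have := x01 j; nra.
  have bl j : - lam j <= beta j <= lam j by rewrite -ler_norml.
  rewrite -(@product_law_chord _ _ _ hx0 hx1 hx _ _ ellp ellm); last 3 first.
  - by move=> j _; have := uL j; have := bl j; rewrite /ellp /u; lra.
  - by move=> j _; have := uL j; have := bl j; rewrite /ellm /u; lra.
  - by move=> j _; have := Lpos j; have := hlam j; rewrite /ellp /ellm; lra.
  rewrite (@product_law_dirac_ends _ _ _ _ _ (x ord0, u0) (x ord_max, u1)) => //; last 2 first.
  - move=> A mA; rewrite inner_indicesE eqxx/= hx0 mul0r addr0.
    exact: uniform_vsegment0.
  - move=> A mA; rewrite inner_indicesE eqxx andbF hx1 mul1r addrC subrK.
    exact: uniform_vsegment0.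
  apply: eq_product_law => [j A mA|]; last exact: measurable_ends_section.
  have jI : midord j \in inner_indices N by rewrite inE val_midord /= ltn_ord.
  by rewrite /= tnth_mktuple jI.
(* [lam] and [beta] vanish at the ends, so the end segments are symmetric about the axis, with
   lengths [w ord0] and [w ord_max]. *)
have V0 : tnth V ord0 = vsegment (x ord0) (- L (x ord0)) (L (x ord0)).
  by rewrite tnth_mktuple /ellm /ellp hlam0 beta0 subr0 !addr0.
have V1 : tnth V ord_max = vsegment (x ord_max) (- L (x ord_max)) (L (x ord_max)).
  by rewrite tnth_mktuple /ellm /ellp hlam1 beta1 subr0 !addr0.
have N0 : - L (x ord0) < L (x ord0) by lra.
have N1 : - L (x ord_max) < L (x ord_max) by lra.
have mpair t : measurable_fun setT (fun y : measurableTypeR R => (t, y) : R * R).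
  exact: measurable_fun_pair.
pose G a := (\int[uniform_segment (tnth V ord_max)]_b H a b)%E.
have mG : measurable_fun setT G by exact: measurable_integral_product_law_ends.
have mH a : measurable_fun setT (H a) by exact: measurable_product_law_ends.
transitivity (product_law (fun j => uniform_segment (tnth V j)) E).
  by apply: fineK; exact: fin_num_measure.
transitivity (\int[uniform_segment (tnth V ord0)]_a G a)%E.
  exact: product_law_ends.
rewrite V0 integral_uniform_vsegment//; last first.
  by move=> a; apply: integral_ge0.
(* The normalising constants of the uniform laws go inside the integrals, to be collected as
   [1 / (w ord0 * w ord_max)]. *)
rewrite -ge0_integralZl//; last 3 first.
- by apply: measurable_funTS; exact: measurableT_comp.
- by move=> y _; apply: integral_ge0.
- by rewrite lee_fin invr_ge0 subr_ge0 ltW.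
apply: eq_integral => u0; rewrite inE => u0L.
rewrite /G V1 integral_uniform_vsegment// muleA -EFinM -ge0_integralZl//; last 2 first.
- by apply: measurable_funTS; exact: (measurableT_comp (mH _) (mpair _)).
- by rewrite lee_fin mulr_ge0// invr_ge0 subr_ge0 ltW.
apply: eq_integral => u1; rewrite inE => u1L.
rewrite HS// -EFinM mulrC; congr (_ * _)%:E.
by rewrite -invfM /w /ellp /ellm hlam0 hlam1 beta0 beta1 !addr0 !subr0 !opprK.
Qed.
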